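(* Let $G(x)=(G_1(x),G_2(x))$, $x\ge0$, be continuous with $G_1(x)>0$, $G_2(x)>0$ for $x>0$, and $\frac{G_2(\cdot)}{G_1(\cdot)}\in C^1(0,+\infty)$. Let $Z=(Z_1,Z_2)$ be a Lévy martingale with nonnegative jumps, having independent coordinates of infinite variation with Laplace exponents varying regularly at zero with indices $\alpha_1,\alpha_2$, respectively, where $2\ge\alpha_1\ge\alpha_2>1$. (I) If $\tilde J_\mu$ is of the form $\tilde J_\mu(b)=\eta_1b^{\alpha_1}$, $b\ge0$, with $\eta_1>0$, $1<\alpha_1\le2$, then $(G,Z)$ is a generating pair if and only if one of the following two cases holds: (a) $G(x)=c_0\,x^{1/\alpha_1}\cdot(\bar G_1,\bar G_2)$, $x\ge0$, where $c_0=\big(\frac{\eta_1}{c_{\alpha_1}}\big)^{1/\alpha_1}$, $\bar G_1>0$, $\bar G_2>0$ are constants, and the process $\bar G_1Z_1(t)+\bar G_2Z_2(t)$, $t\ge0$, is $\alpha_1$-stable; (b) $G$ is such that $c_1G_1^{\alpha_1}(x)+c_2G_2^{\alpha_1}(x)=\eta_1x$, $x\ge0$, with some constants $c_1,c_2>0$, and $Z_1,Z_2$ are $\alpha_1$-stable processes. (II) If $\tilde J_\mu$ is of the form $\tilde J_\mu(b)=\eta_1b^{\alpha_1}+\eta_2b^{\alpha_2}$, $b\ge0$, with $\eta_1,\eta_2>0$, $2\ge\alpha_1>\alpha_2>1$, then $(G,Z)$ is a generating pair if and only if $$G_1(x)=\Big(\frac{\eta_1}{c_1}x\Big)^{1/\alpha_1},\qquad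 G_2(x)=\Big(\frac{\eta_2}{d_2}x\Big)^{1/\alpha_2},\qquad x\ge0,$$ with some $c_1,d_2>0$, and $Z_1$ is $\alpha_1$-stable, $Z_2$ is $\alpha_2$-stable.
   Context: Lévy martingale: a Lévy process that is a martingale. Write $Q$ for the covariance matrix of the Wiener part of $Z$ and $\nu(dy)$ for its Lévy measure. The Laplace exponent $J_Y$ of a real Lévy process $Y$ is defined by $\mathbb{E}[e^{-bY(t)}]=e^{tJ_Y(b)}$, $b\ge0$. For a coordinate with nonnegative jumps, $J_i(b)=\frac12q_{ii}b^2+\int_0^{+\infty}(e^{-bv}-1+bv)\nu_i(dv)$, $q_{ii}\ge0$, $\nu_i$ concentrated on $(0,+\infty)$; $Z_i$ is of infinite variation iff $q_{ii}>0$ or $\int_0^1v\,\nu_i(dv)=+\infty$. $J_i$ varies regularly at zero with index $\alpha$ if $\lim_{x\to0^+}J_i(bx)/J_i(x)=b^\alpha$ for all $b>0$. An $\alpha$-stable process, $\alpha\in(1,2)$, is here a Lévy martingale without Wiener part whose Lévy measure is a positive multiple of $v^{-\alpha-1}\mathbf{1}_{\{v>0\}}dv$; for $\alpha=2$ it is a Wiener process without drift. When the Lévy measure is exactly $v^{-\alpha-1}\mathbf{1}_{\{v>0\}}dv$, the Laplace exponent is $c_\alpha b^\alpha$ with $c_\alpha=\frac{\Gamma(2-\alpha)}{\alpha(\alpha-1)}$, $\Gamma$ being the Gamma function; for $\alpha=2$ the constant in (a) is read as the value $\frac12$. (The subscripted constants $c_1,c_2$ in (b) and $c_1$ in (II)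 are not values of $c_\alpha$.) For $x\ge0$, $Z^{G(x)}(t):=\langle G(x),Z(t)\rangle$ and $\nu_{G(x)}(A):=\nu\{y\in\mathbb{R}^2:\langle G(x),y\rangle\in A\}$. $(G,Z)$ is a generating pair if: $\int_{(0,+\infty)}v\,\nu_{G(0)}(dv)<+\infty$; and there are $c\ge0$ and a measure $\mu$ on $(0,+\infty)$ with $\int_{(0,+\infty)}(v\wedge v^2)\mu(dv)<+\infty$ such that for all $x\ge0$, $\frac12\langle QG(x),G(x)\rangle=cx$ and $\nu_{G(x)}(dv)|_{(0,+\infty)}=\nu_{G(0)}(dv)|_{(0,+\infty)}+x\mu(dv)$. $\tilde J_\mu$ is defined by this $c$ and $\mu$: $\tilde J_\mu(b):=cb^2+\int_0^{+\infty}(e^{-bv}-1+bv)\,\mu(dv)$, $b\ge0$; ''generating pair'' in (I) and (II) is meant with the $c$, $\mu$ giving the stated $\tilde J_\mu$.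
   Formalization: The constants are normalised, as the ''if'' parts fail for arbitrary multiples: in (a) the process has Laplace exponent exactly c_{α1}b^{α1}; in (b) c1, c2 are the constants with J_i(b)=c_i b^{α1}; in (II) J_1(b)=c1 b^{α1}, J_2(b)=d2 b^{α2}. *)

(* Defs.v *)
From HB Require Import structures.
From mathcomp Require Import all_boot all_order all_algebra.
From mathcomp Require Import all_classical all_reals all_analysis.
Set Implicit Arguments.
Unset Strict Implicit.
Unset Printing Implicit Defensive.
Import Order.TTheory GRing.Theory Num.Theory.
Import numFieldNormedType.Exports.
Local Open Scope classical_set_scope.
Local Open Scope ring_scope.

(* Time is the half line 0 <= t of R; values of functions at negative
   arguments never matter. An R^n-valued process is a family
   X : 'I_n -> R -> T -> R, where X i t is the i-th coordinate at time t. *)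

Definition vec2 {A : Type} (a b : A) : 'I_2 -> A :=
  fun i => if i == ord0 then a else b.

Definition dot {R : realType} {n : nat} (u : 'I_n -> R) (y : n.-tuple R) : R :=
  \sum_(i < n) u i * tnth y i.

Definition norm2 {R : realType} {n : nat} (y : n.-tuple R) : R :=
  Num.sqrt (\sum_(i < n) tnth y i ^+ 2).

Definition qform {R : realType} {n : nat} (Q : 'M[R]_n) (u : 'I_n -> R) : R :=
  \sum_(i < n) \sum_(j < n) Q i j * u j * u i.

Section processes.
Context {d : measure_display} {T : measurableType d} {R : realType}.
Variable P : probability T R.

Definition gen_sigma {I : Type} (D : set I) (Y : I -> T -> R) : set (set T) :=
  <<s [set A | exists i, D i /\
         exists B : set R, measurable B /\ A = Y i @^-1` B] >>.

Definition natural_filtration {n : nat} (X : 'I_n -> R -> T -> R) (s : R) :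
    set (set T) :=
  gen_sigma [set ir : 'I_n * R | 0 <= ir.2 <= s] (fun ir => X ir.1 ir.2).

Definition independent_processes (Y1 Y2 : R -> T -> R) : Prop :=
  forall A B : set T,
    gen_sigma [set t : R | 0 <= t] Y1 A -> gen_sigma [set t : R | 0 <= t] Y2 B ->
    P (A `&` B) = (P A * P B)%E.

Definition increment {n : nat} (X : 'I_n -> R -> T -> R) (s t : R) (w : T) :
    n.-tuple R :=
  [tuple X i t w - X i s w | i < n].

Definition independent_increments {n : nat} (X : 'I_n -> R -> T -> R) : Prop :=
  forall s t : R, 0 <= s -> s <= t ->
  forall (A : set T) (B : set (n.-tuple R)),
    natural_filtration X s A -> measurable B ->
    P (A `&` increment X s t @^-1` B) = (P A * P (increment X s t @^-1` B))%E.

Definition stationary_increments {n : nat} (X : 'I_n -> R -> T -> R) : Prop :=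
  forall s h : R, 0 <= s -> 0 <= h ->
  forall B : set (n.-tuple R), measurable B ->
    P (increment X s (s + h) @^-1` B) = P (increment X 0 h @^-1` B).

Definition cadlag (f : R -> R) : Prop :=
  (forall t, 0 <= t -> f s @[s --> t^'+] --> f t) /\
  (forall t, 0 < t -> cvg (f s @[s --> t^'-])).

Definition levy_process {n : nat} (X : 'I_n -> R -> T -> R) : Prop :=
  [/\ forall i t, 0 <= t -> measurable_fun [set: T] (X i t),
      {ae P, forall w, forall i, X i 0 w = 0},
      independent_increments X,
      stationary_increments X &
      {ae P, forall w, forall i, cadlag (fun t => X i t w)}].

Definition martingale (F : R -> set (set T)) (Y : R -> T -> R) : Prop :=
  [/\ forall t, 0 <= t -> forall B : set R, measurable B -> F t (Y t @^-1` B),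
      forall t, 0 <= t -> P.-integrable [set: T] (EFin \o Y t) &
      forall s t, 0 <= s -> s <= t -> forall A, F s A ->
        (\int[P]_(w in A) (Y t w)%:E = \int[P]_(w in A) (Y s w)%:E)%E].

Definition levy_martingale {n : nat} (X : 'I_n -> R -> T -> R) : Prop :=
  levy_process X /\ forall i, martingale (natural_filtration X) (X i).

(* Meant for cadlag paths, for which the left limit exists. *)
Definition nonneg_jumps (Y : R -> T -> R) : Prop :=
  {ae P, forall w, forall t, 0 < t -> lim (Y s w @[s --> t^'-]) <= Y t w}.

(* A Levy process is of finite variation if almost all its paths have bounded
   variation on compact time intervals, and of infinite variation otherwise. *)
Definition infinite_variation (Y : R -> T -> R) : Prop :=
  ~ {ae P, forall w, forall t, 0 <= t ->
       bounded_variation 0 t (fun s => Y s w)}.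

Definition laplace_exponent (Y : R -> T -> R) (J : R -> R) : Prop :=
  forall t b, 0 <= t -> 0 <= b ->
    ('E_P[fun w => expR (- b * Y t w)] = (expR (t * J b))%:E)%E.

(* Q is the covariance matrix of the Wiener part and nu the Levy measure of X,
   for a Levy martingale X whose jumps have nonnegative coordinates: nu is
   carried by the nonnegative orthant minus the origin and the Levy-Khintchine
   formula is written for the Laplace transform. For such processes it
   determines Q and nu, and the centering of the martingale is built in the
   compensator + dot b y. *)
Definition levy_characteristics {n : nat} (X : 'I_n -> R -> T -> R)
    (Q : 'M[R]_n) (nu : {measure set (n.-tuple R) -> \bar R}) : Prop :=
  [/\ Q^T = Q /\ (forall u, 0 <= qform Q u),
      nu [set [tuple (0 : R) | i < n]] = 0%E,
      nu [set y | exists i, tnth y i < 0] = 0%E,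
      (\int[nu]_y (Num.min (norm2 y) (norm2 y ^+ 2))%:E < +oo)%E &
      forall t b, 0 <= t -> (forall i, 0 <= b i) ->
        ('E_P[fun w => expR (- \sum_(i < n) b i * X i t w)] =
         (expR (t * (2^-1 * qform Q b +
            \int[nu]_y (expR (- dot b y) - 1 + dot b y)%R)))%:E)%E].

(* For alpha = 2 the law of a Wiener process without drift is prescribed
   through its characteristics (sigma2, 0). *)
Definition stable_process (alpha : R) (Y : R -> T -> R) : Prop :=
  levy_martingale (fun _ : 'I_1 => Y) /\
  ((1 < alpha < 2 /\
    exists (gamma : R) (nu : {measure set (1.-tuple R) -> \bar R}),
      [/\ 0 < gamma,
          forall B, measurable B ->
            (nu B = \int[lebesgue_measure]_(v in
                       `]0%R, +oo[ `&` [set v : R | B [tuple v]])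
                       (gamma * v `^ (- alpha - 1))%:E)%E &
          levy_characteristics (fun _ : 'I_1 => Y) 0 nu])
   \/
   (alpha = 2 /\
    exists sigma2 : R,
      0 < sigma2 /\ levy_characteristics (fun _ : 'I_1 => Y) sigma2%:M mzero)).

End processes.

Section exponents.
Context {R : realType}.

Definition regularly_varying0 (J : R -> R) (alpha : R) : Prop :=
  forall b : R, 0 < b -> J (b * x) / J x @[x --> 0^'+] --> b `^ alpha.

Definition euler_gamma (s : R) : R :=
  \int[lebesgue_measure]_(t in `]0, +oo[) (t `^ (s - 1) * expR (- t)).

(* The general formula has no meaning at 2, where 1/2 is the exponent constant
   of a standard Wiener process. *)
Definition c_stable (alpha : R) : R :=
  if alpha == 2 then 2^-1
  else euler_gamma (2 - alpha) / (alpha * (alpha - 1)).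

(* A measure on (0, +oo) is a measure on R of which only the trace on
   (0, +oo) is ever used. *)
Definition branching_parameters (c : R) (mu : {measure set R -> \bar R}) :
    Prop :=
  0 <= c /\ (\int[mu]_(v in `]0%R, +oo[) (Num.min v (v ^+ 2))%:E < +oo)%E.

Definition Jmu (c : R) (mu : {measure set R -> \bar R}) (b : R) : R :=
  c * b ^+ 2 + \int[mu]_(v in `]0, +oo[) (expR (- b * v) - 1 + b * v).

Definition projected_measure {n : nat}
    (nu : {measure set (n.-tuple R) -> \bar R}) (u : 'I_n -> R) :
    set R -> \bar R :=
  pushforward nu (dot u).

Definition generating_pair (G : R -> 'I_2 -> R) (Q : 'M[R]_2)
    (nu : {measure set (2.-tuple R) -> \bar R})
    (c : R) (mu : {measure set R -> \bar R}) : Prop :=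
  [/\ branching_parameters c mu,
      (\int[projected_measure nu (G 0%R)]_(v in `]0%R, +oo[) v%:E < +oo)%E,
      forall x, 0 <= x -> 2^-1 * qform Q (G x) = c * x &
      forall x, 0 <= x -> forall A : set R, measurable A -> A `<=` `]0, +oo[ ->
        projected_measure nu (G x) A =
        (projected_measure nu (G 0%R) A + x%:E * mu A)%E].

Definition C1_pos (f : R -> R) : Prop :=
  forall x, 0 < x -> derivable f x 1 /\ {for x, continuous (derive1 f)}.

End exponents.

(* Main.v *)
Require Import Defs.
From HB Require Import structures.
From mathcomp Require Import all_boot all_order all_algebra.
From mathcomp Require Import all_classical all_reals all_analysis.
From mathcomp Require Import measurable_realfun.
From mathcomp Require Import ring lra.
Import Order.TTheory GRing.Theory Num.Theory.
Import numFieldNormedType.Exports.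
Set Implicit Arguments.
Unset Strict Implicit.
Unset Printing Implicit Defensive.
Local Open Scope classical_set_scope.
Local Open Scope ring_scope.

(** By independence the exponent of [<u, Z>] at [b >= 0] is
    [J1 (b u1) + J2 (b u2)], and it is also the Laplace exponent built from the
    variance [<Q u, u> / 2] and the projected measure [nu_u]. A Laplace exponent
    determines its pair (variance, measure on (0, +oo)), so [(G, Z)] is a
    generating pair iff [G 0 = 0] and
      J1 (b G1 x) + J2 (b G2 x) = x Jmu b   for all x > 0, b >= 0.
    That [G 0 = 0] holds for a generating pair comes from the infinite variation:
    otherwise some [J_i] would grow at most linearly, [J_i b <= C b], and then
    [Z_i t + C t] would have nonnegative increments almost surely.

    To solve the equation, put [h = G2 / G1]. If [h] is constant, the equation
    gives [G1] as a power of [x] in case (I), and is contradictory in case (II).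
    If [h y <> h z], subtracting the equations at [y] and [z] gives, with
    [r = h y / h z <> 1], that [J2 (r b) - J2 b] is a combination of powers of
    [b]; correcting [J2] by suitable powers, one gets a function invariant under
    [b |-> r b] and vanishing at [0+], hence zero. So [J1] and [J2] are
    combinations of the same powers; in case (II) the regular variation of [J1]
    and the positivity of [G1] for large [x] kill the unwanted coefficients. *)


(** The exponents are available on the half line [b >= 0] only, so the pair (variance, measure) is
    recovered from their values at the integers, by finite differences. The obstacle is that the
    measure may be infinite near 0 while [psi (b v)] grows linearly in [v]: a second difference of
    stride [j] yields the bounded weight [(1 - exp (- j v))^2], integrable at both ends. It leaves
    the variance as an additive constant, which one more difference removes.

    In the functional equation, invariance under [b |-> r b] alone would allow every function
    periodic in [ln b]; the limit 0 at [0+] is what excludes them.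

    Stability has to be deduced from the shape [c b^a] of an exponent, so a Levy measure must be
    exhibited: scaling shows that the exponent of [v^(-a-1) dv] is a positive multiple of [b^a], and
    rescaling the measure reaches any coefficient [c > 0]. Infinite variation is used a second time
    there, to ensure that the coefficients found in case (b) are positive. *)

(** * The compensated exponential and its bounds *)

Section compensated_exponential.
Context {R : realType}.
Implicit Types x v M r : R.

Definition psi x : R := expR (- x) - 1 + x.

Lemma psi0 : psi 0 = 0.
Proof. by rewrite /psi oppr0 expR0 subrr addr0. Qed.

Lemma psi_ge0 x : 0 <= psi x.
Proof. by have := expR_ge1Dx (- x); rewrite /psi; lra. Qed.

Lemma psi_gt0 x : x != 0 -> 0 < psi x.
Proof.
by move=> x0; have := @expR_gt1Dx R (- x); rewrite oppr_eq0 /psi => /(_ x0);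
  lra.
Qed.

Lemma psi_lex x : 0 <= x -> psi x <= x.
Proof.
by move=> x0; have := expR_le1 (- x); rewrite /psi oppr_le0 x0; lra.
Qed.

Lemma psi_lexx x : 0 <= x -> psi x <= x ^+ 2.
Proof.
move=> x0; have e0 := expR_gt0 (- x).
have h : expR (- x) * (1 + x) <= 1.
  by rewrite -[leRHS](expRxMexpNx_1 x) mulrC ler_pM2r// expR_ge1Dx.
rewrite /psi; set e := expR _ in e0 h *.
(* From [e * (1 + x) <= 1], the left side is at most [1 + (x - 1) * (x + 1) = x ^ 2]. *)
have : (1 + x) * (e - 1 + x) <= (1 + x) * x ^+ 2 by nra.
by rewrite ler_pM2l //; lra.
Qed.

(** The constant serves both branches of the minimum: [x <= M r] where [r] is the smaller,
    [x ^ 2 <= M ^ 2 r ^ 2] where [r ^ 2] is. It transfers integrability from [v] to [b v] and from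
    the norm of a jump to its projection. *)
Lemma min_sqr_le M r x : 0 <= r -> 0 <= x -> x <= M * r ->
  Num.min x (x ^+ 2) <= (M + M ^+ 2) * Num.min r (r ^+ 2).
Proof.
move=> r0 x0 xM.
have [rr|rr] := leP r (r ^+ 2).
  rewrite ge_min (le_trans xM)//.
  by rewrite ler_wpM2r// lerDl sqr_ge0.
rewrite ge_min; apply/orP; right.
apply: (@le_trans _ _ ((M * r) ^+ 2));
  first by rewrite ler_pXn2r ?nnegrE ?(le_trans x0).
rewrite exprMn ler_wpM2r ?sqr_ge0// lerDr.
case: (eqVneq r 0) => [r00|r00]; first by move: rr; rewrite r00 expr0n/= ltxx.
by rewrite -(@pmulr_lge0 _ r) ?(le_trans x0) // lt_def r00.
Qed.

Lemma psi_le_min M r x : 0 <= r -> 0 <= x -> x <= M * r ->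
  psi x <= (M + M ^+ 2) * Num.min r (r ^+ 2).
Proof.
move=> r0 x0 xM; apply: le_trans (min_sqr_le r0 x0 xM).
by rewrite le_min psi_lex// psi_lexx.
Qed.

Lemma continuous_psi : continuous psi.
Proof.
move=> x; apply: cvgD; last exact: cvg_id.
apply: cvgB; last exact: cvg_cst.
apply: (@cvg_comp _ _ _ -%R expR).
  by apply: cvgN; exact: cvg_id.
exact: continuous_expR.
Qed.

Lemma measurable_psi : measurable_fun [set: R] psi.
Proof. by apply: continuous_measurable_fun; exact: continuous_psi. Qed.

Lemma measurable_expRM b : measurable_fun [set: R] (fun v => expR (- (b * v))).
Proof.
by apply: measurableT_comp => //; apply: measurable_funN;
  exact: measurable_funM.
Qed.

Lemma JmuE c (mu : {measure set R -> \bar R}) b :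
  Jmu c mu b = c * b ^+ 2 + \int[mu]_(v in `]0, +oo[) psi (b * v).
Proof.
by rewrite /Jmu; congr (_ + _); apply: eq_Rintegral => v _; rewrite /psi mulNr.
Qed.

Lemma branching_integrable c (mu : {measure set R -> \bar R}) :
  branching_parameters c mu ->
  mu.-integrable `]0, +oo[ (fun v => (Num.min v (v ^+ 2))%:E).
Proof.
move=> [_ h]; apply/integrableP; split.
  apply/measurable_EFinP; apply: measurable_minr => //.
move: h; apply: le_lt_trans; rewrite le_eqVlt; apply/orP; left; apply/eqP.
apply: eq_integral => v; rewrite inE/= in_itv/= andbT => v0.
by rewrite /= ger0_norm// le_min (ltW v0) sqr_ge0.
Qed.

Lemma psi_integrable c (mu : {measure set R -> \bar R}) b : 0 <= b ->
  branching_parameters c mu ->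
  mu.-integrable `]0, +oo[ (fun v => (psi (b * v))%:E).
Proof.
move=> b0 /branching_integrable h.
apply: (le_integrable _ _ _ (integrableZl _ (b + b ^+ 2) h)) => //.
  apply/measurable_EFinP; apply: measurable_funTS.
  by apply: measurableT_comp; [exact: measurable_psi|exact: measurable_funM].
move=> v; rewrite /= in_itv/= andbT => v0.
rewrite lee_fin ger0_norm ?psi_ge0// ger0_norm; last first.
  rewrite mulr_ge0// ?addr_ge0 ?sqr_ge0// le_min (ltW v0) sqr_ge0//.
by apply: psi_le_min => //; [exact: ltW|exact/mulr_ge0/ltW].
Qed.

End compensated_exponential.

(** * A Laplace exponent determines its variance and its measure *)

Section exponent_uniqueness.
Context {R : realType}.
Implicit Types (a v : R) (k n m j : nat).

Let D : set R := `]0, +oo[.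

(* [exp_bump n m j k] is an iterated difference of [b |-> psi (b v)] along the
   integers, so its integral is read off the exponent; with [m ~ n e^(n a)] and
   [n -> +oo] its middle factor tends to the indicator of [v > a], and with
   [j -> +oo] the last factor tends to 1. *)
Definition exp_bump n m j k v : R :=
  expR (- (k%:R * v)) * (1 - expR (- (n%:R * v))) ^+ m *
  (1 - expR (- (j%:R * v))) ^+ 2.

Lemma expRNM_itv n v : 0 <= v -> 0 < expR (- (n%:R * v)) <= 1.
Proof. by move=> v0; rewrite expR_gt0 expR_le1 oppr_le0 mulr_ge0. Qed.

(** Expanding the square gives a second difference of stride [j], in which the affine part of [psi]
    cancels. *)
Lemma exp_bump0E n j k v : exp_bump n 0 j k v =
  psi ((k + j + j)%:R * v) - 2 * psi ((k + j)%:R * v) + psi (k%:R * v).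
Proof.
rewrite /exp_bump /psi !natrD !mulrDl !opprD !expRD expr0 mulr1.
by ring.
Qed.

Lemma exp_bumpS n m j k v : exp_bump n m.+1 j k v =
  exp_bump n m j k v - exp_bump n m j (k + n) v.
Proof. by rewrite /exp_bump natrD mulrDl opprD expRD exprS; ring. Qed.

Lemma exp_bump_itv n m j k v : 0 <= v ->
  0 <= exp_bump n m j k v <= (1 - expR (- (j%:R * v))) ^+ 2.
Proof.
move=> v0.
have /andP[a1 a2] := expRNM_itv k v0; have /andP[b1 b2] := expRNM_itv n v0.
have h : 0 <= expR (- (k%:R * v)) * (1 - expR (- (n%:R * v))) ^+ m <= 1.
  rewrite mulr_ge0 ?(ltW a1) ?exprn_ge0 ?subr_ge0//= mulr_ile1 ?exprn_ge0
    ?subr_ge0 ?(ltW a1)//.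
  by rewrite exprn_ile1 ?subr_ge0// lerBlDr lerDl ltW.
rewrite /exp_bump mulr_ge0 ?sqr_ge0//=; last by case/andP: h.
by rewrite ler_piMl ?sqr_ge0//; case/andP: h.
Qed.

Lemma sqr_1BexpR_le1 j v : 0 <= v -> (1 - expR (- (j%:R * v))) ^+ 2 <= 1.
Proof.
move=> v0; have /andP[a1 a2] := expRNM_itv j v0.
by rewrite exprn_ile1 ?subr_ge0// lerBlDr lerDl ltW.
Qed.

Lemma measurable_exp_bump n m j k : measurable_fun [set: R] (exp_bump n m j k).
Proof.
have me i : measurable_fun [set: R] (fun v : R => expR (- (i%:R * v))).
  exact: measurable_expRM.
apply: measurable_funM; [apply: measurable_funM => //|];
  apply: measurable_funX; exact: measurable_funB.
Qed.

Lemma subr_onemXn_ge (u : R) m : 0 <= u <= 1 -> 1 - m%:R * u <= (1 - u) ^+ m.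
Proof.
move=> /andP[u0 u1]; elim: m => [|m IH]; first by rewrite mul0r subr0 expr0.
rewrite exprS -natr1; have m0 : 0 <= m%:R :> R by [].
have := ler_wpM2l (_ : 0 <= 1 - u) IH; rewrite subr_ge0 => /(_ u1).
by apply: le_trans; nra.
Qed.

(** Since [exp (n v) >= 1 + n v], it is enough that [(1 + 1/v) * (1 + n v) >= n + 1]. The explicit
    rate feeds the squeeze arguments below. *)
Lemma expRNM_le_harmonic n v : 0 < v ->
  expR (- (n%:R * v)) <= (1 + v^-1) * harmonic n.
Proof.
move=> v0.
rewrite expRN /harmonic -[leLHS]mul1r ler_pdivrMr ?expR_gt0// mulrAC
  ler_pdivlMr ?ltr0Sn//.
have n0 : 0 <= n%:R :> R by [].
have v1 : 0 <= v^-1 by rewrite invr_ge0 ltW.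
apply: (@le_trans _ _ ((1 + v^-1) * (1 + n%:R * v))); last first.
  by rewrite ler_wpM2l ?expR_ge1Dx// addr_ge0.
have -> : (1 + v^-1) * (1 + n%:R * v) = 1 + n%:R + v^-1 + n%:R * v.
  by field; rewrite gt_eqF.
by rewrite -natr1; nra.
Qed.

Lemma expRNM_cvg0 v : 0 < v -> expR (- (n%:R * v)) @[n --> \oo] --> (0 : R).
Proof.
move=> v0; apply: (squeeze_cvgr (f := fun=> 0) (h := fun n =>
  (1 + v^-1) * harmonic n)).
- by near=> n; rewrite expR_ge0 expRNM_le_harmonic.
- exact: cvg_cst.
- rewrite -[X in _ --> X](mulr0 (1 + v^-1)); apply: cvgMr; exact: cvg_harmonic.
Unshelve. all: by end_near. Qed.

(** With [u = exp (- n v)] and [m] the exponent, the power behaves like [exp (- m u)], where [m u]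
    is about [n exp (n (a - v))]: it tends to infinity for [v <= a] and to 0 for [v > a]. The factor
    [n] in [m] settles the boundary case [v = a], so that the ray is open. *)
Lemma indic_ray_cvg a v : 0 <= a -> 0 <= v ->
  (1 - expR (- (n%:R * v))) ^+ (Num.truncn (n%:R * expR (n%:R * a))).+1
    @[n --> \oo] --> (\1_(`]a, +oo[%classic : set R) v : R).
Proof.
move=> a0 v0.
have mlo n : n%:R * expR (n%:R * a) <
    (Num.truncn (n%:R * expR (n%:R * a))).+1%:R.
  by rewrite truncnS_gt.
have mhi n : (Num.truncn (n%:R * expR (n%:R * a)))%:R <= n%:R * expR (n%:R * a).
  by rewrite truncn_le// mulr_ge0// expR_ge0.
have [va|av] := leP v a.
  rewrite indicE memNset/=; last by rewrite in_itv/= andbT ltNge va.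
  apply: (squeeze_cvgr (f := fun=> 0) (h := harmonic)); last 2 first.
  - exact: cvg_cst.
  - exact: cvg_harmonic.
  near=> n; have /andP[u0 u1] := expRNM_itv n v0.
  rewrite exprn_ge0 ?subr_ge0//=.
  set m := (_.+1)%N; set u := expR _ in u0 u1 *.
  have mu : n%:R <= m%:R * u.
    apply: (@le_trans _ _ (n%:R * expR (n%:R * a) * u)).
      rewrite -mulrA ler_peMr// /u -expRD -expR0 ler_expR subr_ge0.
      by rewrite ler_wpM2l.
    by rewrite ler_pM2r// ltW// mlo.
  apply: (@le_trans _ _ (expR (- u) ^+ m)).
    rewrite lerXn2r ?nnegrE ?subr_ge0 ?expR_ge0//.
    exact: expR_ge1Dx.
  rewrite -expRM_natl mulrN expRN lef_pV2 ?posrE ?expR_gt0//.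
  apply: (le_trans _ (expR_ge1Dx _)); rewrite -natr1 addrC lerD2l.
  by rewrite (le_trans mu)// mulrC.
rewrite indicE mem_set/=; last by rewrite in_itv/= andbT.
set x := v - a; have x0 : 0 < x by rewrite subr_gt0.
have v1 : 0 < v by apply: le_lt_trans av.
(* By Bernoulli the power is at least [1 - m u]. The truncation in [m] contributes at most
   [n exp (- n x)], bounded through [exp y >= 1 + y ^ 2 / 2], whence [4 / x ^ 2]; the successor
   contributes [u] itself, whence [1 + 1/v]. *)
apply: (squeeze_cvgr (f := fun n => 1 - (4 / x ^+ 2 + 1 + v^-1) * harmonic n)
   (h := fun=> 1)); last 2 first.
- rewrite -[X in _ --> X]subr0; apply: cvgB; first exact: cvg_cst.
  rewrite -[X in _ --> X](mulr0 (4 / x ^+ 2 + 1 + v^-1)).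
  by apply: cvgMr; exact: cvg_harmonic.
- exact: cvg_cst.
near=> n; have /andP[u0 u1] := expRNM_itv n v0.
rewrite exprn_ile1 ?subr_ge0 ?andbT; last 2 first.
- exact: u1.
- by rewrite lerBlDr lerDl ltW.
apply: le_trans (subr_onemXn_ge _ _); last by rewrite ltW.
rewrite lerD2l lerN2 -natr1 mulrDl mul1r -addrA mulrDl.
have n0 : 0 <= n%:R :> R by [].
apply: lerD.
  apply: (@le_trans _ _ (n%:R * expR (n%:R * a) * expR (- (n%:R * v)))).
    by rewrite ler_pM2r// mhi.
  rewrite -mulrA -expRD -opprB -mulrBr -/x expRN.
  rewrite /harmonic ler_pdivrMr ?expR_gt0// mulrAC ler_pdivlMr ?ltr0Sn//.
  have := @expR_ge1Dxn R (n%:R * x) 1; rewrite mulr_ge0 ?(ltW x0)// => /(_ isT).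
  rewrite (_ : 2`! = 2)%N// -natr1; set e := expR _ => he.
  apply: (@le_trans _ _ (4 / x ^+ 2 * (1 + (n%:R * x) ^+ 2 / 2%:R)));
    last first.
    by rewrite ler_wpM2l// divr_ge0// sqr_ge0.
  have -> : 4 / x ^+ 2 * (1 + (n%:R * x) ^+ 2 / 2%:R) =
    4 / x ^+ 2 + 2 * n%:R ^+ 2.
    by field; rewrite gt_eqF.
  have : 0 <= 4 / x ^+ 2 by rewrite divr_ge0// sqr_ge0.
  have : n%:R <= n%:R ^+ 2 :> R by rewrite -natrX ler_nat; case: (n) => // k;
    rewrite leq_pmulr.
  by rewrite -natr1; nra.
exact: expRNM_le_harmonic.
Unshelve. all: by end_near. Qed.


Variables (q1 q2 : R) (m1 m2 : {measure set R -> \bar R}).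
Hypotheses (bp1 : branching_parameters q1 m1) (bp2 : branching_parameters q2
  m2).
Hypothesis eqJ : forall b, 0 <= b -> Jmu q1 m1 b = Jmu q2 m2 b.

Let mD : measurable D. Proof. exact: measurable_itv. Qed.

Let D_gt0 v : D v -> 0 < v. Proof. by rewrite /D/= in_itv/= andbT. Qed.

Lemma exp_bump_integrable q (mu : {measure set R -> \bar R}) n m j k :
  branching_parameters q mu -> mu.-integrable D (EFin \o exp_bump n m j k).
Proof.
move=> bp.
have i0 : mu.-integrable D (EFin \o exp_bump n 0 j 0).
  apply: (eq_integrable mD (fun v => (psi ((0 + j + j)%:R * v))%:E -
    2%:E * (psi ((0 + j)%:R * v))%:E + (psi (0%:R * v))%:E)%E).
    by move=> v _; rewrite /= exp_bump0E.
  apply: integrableD => //; last exact: psi_integrable bp.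
  apply: integrableB => //; first exact: psi_integrable bp.
  by apply: integrableZl => //; exact: psi_integrable bp.
apply: (le_integrable mD _ _ i0).
  by apply/measurable_EFinP; apply: measurable_funTS;
    exact: measurable_exp_bump.
move=> v Dv; have v0 := ltW (D_gt0 Dv).
have /andP[h1 h2] := exp_bump_itv n m j k v0.
have /andP[h3 _] := exp_bump_itv n 0 j 0 v0.
rewrite /= lee_fin !ger0_norm//; apply: (le_trans h2).
by rewrite /exp_bump mul0r oppr0 expR0 expr0 !mul1r.
Qed.

(** The second difference of [q b ^ 2] with stride [j] is [2 j ^ 2 q] whatever [k] is. The
    discrepancy between the two measures is therefore constant in [k], and disappears in the next
    difference, which shifts [k] by [n]. *)
Let eq_exp_bump0 n j k :
  \int[m1]_(v in D) exp_bump n 0 j k v =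
  \int[m2]_(v in D) exp_bump n 0 j k v + 2 * j%:R ^+ 2 * (q2 - q1).
Proof.
have E q (mu : {measure set R -> \bar R}) : branching_parameters q mu ->
    \int[mu]_(v in D) exp_bump n 0 j k v =
    Jmu q mu (k + j + j)%:R - 2 * Jmu q mu (k + j)%:R + Jmu q mu k%:R
    - 2 * j%:R ^+ 2 * q.
  move=> bp; have ip := psi_integrable _ bp.
  under eq_Rintegral do rewrite exp_bump0E.
  rewrite RintegralD//; last 2 first.
  - exact: (integrableB mD (ip _ (ler0n _ _))
      (integrableZl mD 2 (ip _ (ler0n _ _)))).
  - exact: ip.
  rewrite RintegralB//; [|exact: ip|exact: (integrableZl mD 2 (ip _ (ler0n _
    _)))].
  rewrite RintegralZl//; last exact: ip.
  by rewrite !JmuE !natrD; ring.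
by rewrite (E _ _ bp1) (E _ _ bp2) !eqJ//; set x := _ - _ + _; ring.
Qed.

Let eq_exp_bumpS n m j k :
  \int[m1]_(v in D) exp_bump n m.+1 j k v =
    \int[m2]_(v in D) exp_bump n m.+1 j k v.
Proof.
have E i (mu : {measure set R -> \bar R}) q k' : branching_parameters q mu ->
    \int[mu]_(v in D) exp_bump n i.+1 j k' v =
    \int[mu]_(v in D) exp_bump n i j k' v - \int[mu]_(v in D) exp_bump n i j
      (k' + n) v.
  move=> bp; under eq_Rintegral do rewrite exp_bumpS.
  by rewrite RintegralB//; exact: exp_bump_integrable bp.
elim: m k => [|m IH] k; rewrite (E _ _ _ _ bp1) (E _ _ _ _ bp2).
  by rewrite !eq_exp_bump0 opprD addrACA subrr addr0.
by rewrite !IH.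
Qed.

(** Dominated convergence. The bound [exp_bump 0 0 j 0] is the bare weight [(1 - exp (- j v))^2],
    which vanishes to second order at 0 and hence is integrable even if [mu] is infinite there. *)
Lemma exp_bump_cvg_integral q (mu : {measure set R -> \bar R}) a j :
    branching_parameters q mu -> 0 <= a ->
  (\int[mu]_(v in D) (exp_bump n (Num.truncn (n%:R * expR (n%:R * a))).+1 j 0
    v)%:E)%E
    @[n --> \oo] -->
  (\int[mu]_(v in `]a, +oo[) ((1 - expR (- (j%:R * v))) ^+ 2)%:E)%E.
Proof.
move=> bp a0.
have -> : (\int[mu]_(v in `]a, +oo[) ((1 - expR (- (j%:R * v))) ^+ 2)%:E =
    \int[mu]_(v in D) (\1_(`]a, +oo[%classic : set R) v *
      (1 - expR (- (j%:R * v))) ^+ 2)%:E)%E.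
  rewrite [in LHS](_ : `]a, +oo[%classic = D `&` `]a, +oo[%classic); last first.
    apply/seteqP; split => v /=; last by case.
    rewrite /D/= !in_itv/= !andbT => av; split => //; exact: le_lt_trans av.
  rewrite integral_mkcondr; apply: eq_integral => v _.
  by rewrite patchE indicE; case: ifPn => h; rewrite ?mul1r ?mul0r.
have me : measurable_fun [set: R] (fun v : R => (1 - expR (- (j%:R * v))) ^+ 2).
  by apply: measurable_funX; apply: measurable_funB => //;
    exact: measurable_expRM.
have [] // := @dominated_convergence _ _ _ mu D mD
  (fun n v => (exp_bump n (Num.truncn (n%:R * expR (n%:R * a))).+1 j 0 v)%:E)
  (fun v => (\1_(`]a, +oo[%classic : set R) v * (1 - expR (- (j%:R * v))) ^+
    2)%:E)
  (fun v => (exp_bump 0 0 j 0 v)%:E).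
- move=> n; apply/measurable_EFinP; apply: measurable_funTS;
  exact: measurable_exp_bump.
- apply/measurable_EFinP; apply: measurable_funTS; apply: measurable_funM => //.
- apply: aeW => v /= Dv; apply: cvg_EFin; first by near=> n.
  have v0 := ltW (D_gt0 Dv).
  rewrite /comp/= /exp_bump; apply: cvgMl.
  under eq_fun do rewrite mul0r oppr0 expR0 mul1r.
  exact: indic_ray_cvg.
- exact: exp_bump_integrable bp.
- apply: aeW => v /= n Dv; have v0 := ltW (D_gt0 Dv).
  have /andP[h1 h2] := exp_bump_itv n (Num.truncn (n%:R * expR (n%:R * a))).+1
    j 0 v0.
  rewrite lee_fin ger0_norm//; apply: (le_trans h2).
  by rewrite /exp_bump mul0r oppr0 expR0 expr0 !mul1r.
Unshelve. all: by end_near. Qed.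

Let eq_sqr a j : 0 <= a ->
  (\int[m1]_(v in `]a, +oo[) ((1 - expR (- (j%:R * v))) ^+ 2)%:E =
   \int[m2]_(v in `]a, +oo[) ((1 - expR (- (j%:R * v))) ^+ 2)%:E)%E.
Proof.
move=> a0; have h1 := exp_bump_cvg_integral (j := j) bp1 a0;
  have h2 := exp_bump_cvg_integral (j := j) bp2 a0.
have E q (mu : {measure set R -> \bar R}) n m : branching_parameters q mu ->
   (\int[mu]_(v in D) (exp_bump n m j 0 v)%:E)%E =
     (\int[mu]_(v in D) (exp_bump n m j 0 v))%:E.
  move=> bp; rewrite /Rintegral fineK//.
  by apply: integrable_fin_num => //; exact: exp_bump_integrable bp.
move: h1; under eq_fun do rewrite (E _ _ _ _ bp1) eq_exp_bumpS -(E _ _ _ _ bp2).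
by move=> h1; exact: (cvg_unique _ h1 h2).
Qed.

Lemma branching_ray_lty q (mu : {measure set R -> \bar R}) a :
  branching_parameters q mu -> 0 < a -> (mu `]a, +oo[%classic < +oo)%E.
Proof.
move=> [_ bp] a0; set C := Num.min a (a ^+ 2).
have C0 : 0 < C by rewrite lt_min a0 exprn_gt0.
rewrite -(@lte_pmul2l _ C%:E)//.
rewrite -(integral_cst mu (measurable_itv _)) mulry gtr0_sg// mul1e.
apply: le_lt_trans bp.
apply: (@le_trans _ _ (\int[mu]_(v in `]a, +oo[) (Num.min v (v ^+ 2))%:E)%E).
  apply: ge0_le_integral => //.
  - by move=> v _; rewrite lee_fin ltW.
  - by apply/measurable_EFinP; apply: measurable_minr.
  - move=> v /=; rewrite in_itv/= andbT => av; have v0 := lt_trans a0 av.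
    rewrite lee_fin le_min !ge_min (ltW av)/=; apply/orP; right.
    by rewrite lerXn2r ?nnegrE ?ltW.
apply: ge0_subset_integral => //.
- by apply/measurable_EFinP; apply: measurable_minr.
- move=> v /D_gt0 v0; by rewrite lee_fin le_min ltW//= sqr_ge0.
- move=> v /=; rewrite !in_itv/= !andbT; exact: lt_trans.
Qed.

Let sqr_cvg q (mu : {measure set R -> \bar R}) a :
  branching_parameters q mu -> 0 < a ->
  (\int[mu]_(v in `]a, +oo[) ((1 - expR (- (j%:R * v))) ^+ 2)%:E)%E @[j --> \oo]
   --> mu `]a, +oo[%classic.
Proof.
move=> bp a0.
have -> : (mu `]a, +oo[%classic = \int[mu]_(v in `]a, +oo[) (cst 1 v))%E.
  by rewrite integral_cst// mul1e.
have [] // := @dominated_convergence _ _ _ mu `]a,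
  +oo[%classic (measurable_itv _)
  (fun j v => ((1 - expR (- (j%:R * v))) ^+ 2)%:E) (cst 1%E) (cst 1%E).
- move=> j; apply/measurable_EFinP; apply: measurable_funTS;
  apply: measurable_funX.
  by apply: measurable_funB => //; exact: measurable_expRM.
- apply: aeW => v /=; rewrite in_itv/= andbT => av.
  have v0 := lt_trans a0 av.
  apply: cvg_EFin; first by near=> n.
  rewrite -[X in _ --> X](expr1n R 2) /comp/=.
  apply: cvgM; (rewrite -[X in _ --> X]subr0; apply: cvgB;
    first exact: cvg_cst);
    exact: expRNM_cvg0.
- apply/integrableP; split => //; under eq_integral do rewrite abse1.
  by rewrite integral_cst// mul1e; exact: branching_ray_lty bp a0.
- apply: aeW => v /= j; rewrite in_itv/= andbT => av.
  have v0 := lt_trans a0 av.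
  by rewrite lee_fin ger0_norm ?sqr_ge0// sqr_1BexpR_le1// ltW.
Unshelve. all: by end_near. Qed.

Let eq_ray a : 0 < a -> m1 `]a, +oo[%classic = m2 `]a, +oo[%classic.
Proof.
move=> a0; have h1 := sqr_cvg bp1 a0; have h2 := sqr_cvg bp2 a0.
move: h1; under eq_fun do rewrite (eq_sqr _ (ltW a0)).
by move=> h1; exact: (cvg_unique _ h1 h2).
Qed.

(** The open rays form a pi-system generating the Borel sets. Restricted to []a, +oo[], all of them
    have finite measure, including the exhausting rays []- k, +oo[]; without the restriction they
    could be infinite. *)
Let eq_above a A : 0 < a -> measurable A -> m1 (A `&` `]a,
  +oo[) = m2 (A `&` `]a, +oo[).
Proof.
move=> a0 mA; have mE : measurable (`]a, +oo[%classic : set R) by [].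
have E x : `]x, +oo[ `&` `]a, +oo[ = `](Num.max x a), +oo[%classic.
  by apply/seteqP; split => v /=; rewrite !in_itv/= !andbT gt_max => /andP.
have ER (m : {measure set R -> \bar R}) x :
    mrestr m mE `]x, +oo[%classic = m `](Num.max x a), +oo[%classic.
  by rewrite /mrestr; congr (m _); exact: E.
apply: (measure_unique (@RGenOInfty.G R) (fun k => `](- k%:R), +oo[%classic)
  _ _ _ _ (mrestr m1 mE) (mrestr m2 mE)) => //.
- exact: RGenOInfty.measurableE.
- move=> _ _ [x ->] [y ->]; exists (Num.max x y).
  by apply/seteqP; split => v /=; rewrite !in_itv/= !andbT gt_max => /andP.
- by move=> i; eexists.
- apply/seteqP; split => // v _; exists (Num.truncn `|v|).+1 => //=.
  rewrite in_itv/= andbT ltrNl; apply: le_lt_trans (truncnS_gt _).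
  by rewrite lerNl lerNnormlW.
- by move=> _ [x ->]; rewrite [LHS]ER [RHS]ER; apply: eq_ray;
  rewrite lt_max a0 orbT.
- move=> k; rewrite [ltLHS]ER; apply: branching_ray_lty bp1 _.
  by rewrite lt_max a0 orbT.
Qed.

Let eq_pos A : measurable A -> A `<=` D -> m1 A = m2 A.
Proof.
move=> mA AD; pose F n := A `&` `]n.+1%:R^-1, +oo[%classic.
have FA : \bigcup_n F n = A.
  apply/seteqP; split => [v [n _ []]//|v Av].
  have v0 : 0 < v by apply: D_gt0; exact: AD.
  exists (Num.truncn v^-1) => //; split => //=; rewrite in_itv/= andbT.
  by rewrite invf_plt ?posrE// truncnS_gt.
have cvgF (m : {measure set R -> \bar R}) : m (F n) @[n --> \oo] --> m A.
  rewrite -FA; apply: nondecreasing_cvg_mu.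
  - by move=> i; exact: measurableI.
  - by rewrite FA.
  - move=> i j ij; apply/subsetPset; apply: setIS => v /=;
    rewrite !in_itv/= !andbT.
    by apply: le_lt_trans; rewrite lef_pV2 ?posrE// ler_nat.
move: (cvgF m1); under eq_fun do rewrite eq_above ?invr_gt0//.
by move=> h; exact: (cvg_unique _ h (cvgF m2)).
Qed.

Lemma Jmu_inj : q1 = q2 /\ forall A, measurable A -> A `<=` D -> m1 A = m2 A.
Proof.
split; last exact: eq_pos.
(* The measures now agree, so the equation at [b = 1] reduces to the variances. *)
have := eqJ (@ler01 R); rewrite !JmuE expr1n !mulr1 /Rintegral.
rewrite (@eq_measure_integral _ _ _ _ m2); first exact: addIr.
exact: eq_pos.
Qed.

End exponent_uniqueness.


(** * Measures with a density *)

Section density.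
Local Open Scope ereal_scope.
Context d (T : measurableType d) (R : realType).
Variables (mu : {measure set T -> \bar R}) (f : T -> R).
Hypotheses (mf : measurable_fun [set: T] f) (f0 : forall x, (0 <= f x)%R).

(** The two properties of [f] are arguments of the constant, so that the measure structure declared
    on it can be inferred from the term itself. *)
Definition density of measurable_fun [set: T] f & (forall x, (0 <= f x)%R) :=
  fun A : set T => \int[mu]_(x in A) (f x)%:E.

Let dens := density mf f0.

Let mfE : measurable_fun [set: T] (EFin \o f).
Proof. exact/measurable_EFinP. Qed.

Let f0E x : 0 <= (f x)%:E. Proof. by rewrite lee_fin. Qed.

Let dens0 : dens set0 = 0. Proof. exact: integral_set0. Qed.

Let dens_ge0 A : 0 <= dens A. Proof. by apply: integral_ge0 => x _;
  exact: f0E. Qed.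

Let dens_sigma_additive : semi_sigma_additive dens.
Proof.
move=> F mF tF mUF; rewrite /dens /density ge0_integral_bigcup//.
- by apply: is_cvg_ereal_nneg_natsum => n _; apply: integral_ge0 => x _;
  exact: f0E.
- exact: measurable_funTS.
Qed.

HB.instance Definition _ := isMeasure.Build _ _ _ (density mf f0)
  dens0 dens_ge0 dens_sigma_additive.

Import HBNNSimple.

Let integral_density_nnsfun (h : {nnsfun T >-> R}) :
  \int[density mf f0]_x (h x)%:E = \int[mu]_x ((h x)%:E * (f x)%:E).
Proof.
rewrite integralT_nnsfun sintegralE.
transitivity (\int[mu]_x (\sum_(k \in range h)
    (k * \1_(h @^-1` [set k]) x)%:E * (f x)%:E)); last first.
  apply: eq_integral => x _; rewrite fimfunE -fsumEFin// ge0_mule_fsuml//.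
  by move=> r; rewrite nnfun_muleindic_ge0.
rewrite ge0_integral_fsum//; last 2 first.
- move=> r; apply: emeasurable_funM => //.
  by apply/measurable_EFinP; apply: measurable_funM.
- by move=> r x _; rewrite mule_ge0// nnfun_muleindic_ge0.
apply: eq_fsbigr => r /[!inE] -[x _ hx].
have r0 : (0 <= r)%R by rewrite -hx.
under [RHS]eq_integral do rewrite EFinM -muleA.
rewrite ge0_integralZl//; last 2 first.
- by apply: emeasurable_funM => //; apply/measurable_EFinP.
- by move=> y _; rewrite mule_ge0// lee_fin.
congr (_ * _); rewrite -[LHS]/(\int[mu]_(x in h @^-1` [set r]) (f x)%:E).
rewrite integral_mkcond epatch_indic.
by apply: eq_integral => y _; rewrite /= muleC.
Qed.

Lemma ge0_integral_density (g : T -> \bar R) :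
  measurable_fun [set: T] g -> (forall x, 0 <= g x) ->
  \int[density mf f0]_x g x = \int[mu]_x (g x * (f x)%:E).
Proof.
move=> mg g0; pose g_ := nnsfun_approx measurableT mg.
have g_cvg x : (g_ n x)%:E @[n --> \oo] --> g x by exact: cvg_nnsfun_approx.
have g_nd x : {homo (fun n => (g_ n x)%:E) : m n / (m <= n)%N >-> m <= n}.
  by move=> m n mn; rewrite lee_fin; exact/lefP/nd_nnsfun_approx.
transitivity (limn (fun n => \int[density mf f0]_x (g_ n x)%:E)).
  rewrite -monotone_convergence//.
  - by apply: eq_integral => x _; apply/esym/cvg_lim.
  - by move=> n; exact/measurable_EFinP.
  - by move=> n x _; rewrite lee_fin.
rewrite (_ : (fun n => _) = fun n => \int[mu]_x ((g_ n x)%:E * (f x)%:E));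
  last first.
  by apply/funext => n; exact: integral_density_nnsfun.
rewrite -monotone_convergence//.
- apply: eq_integral => x _; apply/cvg_lim => //.
  by apply: cvgeZr => //; exact: g_cvg.
- by move=> n; apply: emeasurable_funM => //; exact/measurable_EFinP.
- by move=> n x _; rewrite mule_ge0// lee_fin.
- by move=> x _ m n mn; apply: lee_wpmul2r => //; exact: g_nd.
Qed.

End density.

(** * Power integrals and the constant of the stable density *)

Section power_integrals.
Context {R : realType}.
Implicit Types (a b p v : R).
Local Notation lambda := (@lebesgue_measure R).

Lemma integral_powR a b p : 0 < a -> a < b -> p != -1 ->
  (\int[lambda]_(v in `[a, b]) (v `^ p)%:E =
   ((b `^ (p + 1) - a `^ (p + 1)) / (p + 1))%:E)%E.
Proof.
move=> a0 ab p1.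
have p0 : p + 1 != 0 by rewrite addr_eq0.
have b0 : 0 < b by apply: lt_trans ab.
have dF v : 0 < v -> is_derive v 1 (fun x => x `^ (p + 1) / (p + 1)) (v `^ p).
  move=> v0; have H := @is_derive1_powR R (p + 1) v v0.
  have -> : v `^ p = (p + 1)^-1 *: ((p + 1) * v `^ (p + 1 - 1)).
    by rewrite addrK /GRing.scale/= mulKf.
  have -> : (fun x => x `^ (p + 1) / (p + 1)) = (p + 1)^-1 *: (fun x =>
    x `^ (p + 1)).
    by apply/funext => x; rewrite /= mulrC.
  exact: is_deriveZ.
have cF v : 0 < v -> {for v, continuous (fun x => x `^ (p + 1) / (p + 1))}.
  by move=> v0; apply: differentiable_continuous; apply/derivable1_diffP;
    case: (dF _ v0).
have cf v : 0 < v -> {for v, continuous (fun x : R => x `^ p)}.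
  move=> v0; apply: differentiable_continuous; apply/derivable1_diffP.
  by apply: derivable_powR; rewrite in_itv/= v0.
rewrite (continuous_FTC2 (F := fun x => x `^ (p + 1) / (p + 1)) ab).
- by rewrite -EFinB mulrBl.
- apply: continuous_in_subspaceT => v; rewrite inE/= in_itv/= => /andP[av _].
  by apply: cf; exact: lt_le_trans av.
- split.
  + move=> v; rewrite in_itv/= => /andP[av _].
    by case: (dF _ (lt_trans a0 av)).
  + by apply: cvg_at_right_filter; exact: cF.
  + by apply: cvg_at_left_filter; exact: cF.
- move=> v; rewrite in_itv/= => /andP[av _].
  by rewrite derive1E; apply: (@derive_val _ _ _ _ _ _ _ (dF _ (lt_trans a0
    av))).
Qed.

Lemma integral_scale (h : R -> \bar R) b : 0 < b ->
  measurable_fun [set: R] h -> (forall v, 0 <= h v)%E ->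
  (\int[lambda]_(v in `]0%R, +oo[) h (b * v)%R =
   b^-1%:E * \int[lambda]_(v in `]0%R, +oo[) h v)%E.
Proof.
move=> b0 mh h0.
have bi0 : 0 <= b^-1 by rewrite invr_ge0 ltW.
have mb : measurable_fun [set: measurableTypeR R] ( *%R b : measurableTypeR R
  -> measurableTypeR R).
  exact: mulrl_measurable.
rewrite [in LHS](_ : `]0, +oo[%classic = ( *%R b) @^-1` `]0, +oo[%classic);
  last first.
  by apply/seteqP; split => v /=; rewrite !in_itv/= !andbT pmulr_rgt0.
rewrite -[LHS](ge0_integral_pushforward mb lambda)//;
  last exact: measurable_funTS.
rewrite -(ge0_integral_mscale lambda _ (NngNum bi0))//;
  last exact: measurable_funTS.
apply: eq_measure_integral => A mA _.
(* Lebesgue measure is [b] times its image under [v |-> b v]: the two agree on half-open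
   intervals. *)
have key : forall A, measurable A -> lambda A =
  (mscale (NngNum (ltW b0)) (pushforward lambda ( *%R b : measurableTypeR R ->
  measurableTypeR R)) A).
  move=> m'; apply: lebesgue_measure_unique => _ [[x y] _ <-].
  transitivity (b%:E * lambda `](b^-1 * x)%R, (b^-1 * y)%R]%classic)%E;
    last first.
    rewrite /mscale /pushforward /=; congr (_ * lambda _)%E.
    by apply/seteqP; split => v /=; rewrite !in_itv/= ltr_pdivrMl// ler_pdivlMl.
  rewrite !lebesgue_measure_itv/= !lte_fin ltr_pM2l ?invr_gt0//.
  case: ifP => _; last by rewrite mule0.
  by rewrite -!EFinB -EFinM -mulrBr mulVKf// gt_eqF.
rewrite -[RHS]/(b^-1%:E * lambda A)%E (key mb A mA).
rewrite -[X in (_ * X)%E]/(b%:E * pushforward lambda ( *%R b) A)%E.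
by rewrite muleA -EFinM mulVf ?gt_eqF// mul1e.
Qed.


Lemma integral_powR_near0 p : -1 < p ->
  (\int[lambda]_(v in `]0%R, 1%R]) (v `^ p)%:E < +oo)%E.
Proof.
move=> p1; have p0 : 0 < p + 1 by lra.
have mp : measurable_fun [set: R] (fun v : R =>
  v `^ p) by exact: measurable_powR.
have pp v : 0 <= v `^ p :> R by exact: powR_ge0.
rewrite -[ltLHS]/(density lambda mp pp `]0%R, 1%R]%classic).
(* The index is shifted by two so that every interval is nondegenerate, as [integral_powR]
   requires. *)
have U : \bigcup_n `[n.+2%:R^-1, 1%R]%classic = `]0%R, 1%R]%classic :> set R.
  apply/seteqP; split => v /=.
    move=> [n _] /=; rewrite !in_itv/= => /andP[h ->]; rewrite andbT.
    by apply: lt_le_trans h; rewrite invr_gt0.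
  rewrite in_itv/= => /andP[v0 v1]; exists (Num.truncn v^-1) => //=.
  rewrite in_itv/= v1 andbT invf_ple ?posrE//.
  by apply: (le_trans (ltW (truncnS_gt _))); rewrite ler_nat.
apply: (@le_lt_trans _ _ (p + 1)^-1%:E); last exact: ltry.
have H := @nondecreasing_cvg_mu _ _ _ (density lambda mp pp)
  (fun n => `[n.+2%:R^-1, 1%R]%classic); rewrite /= U in H.
have {}H : (density lambda mp pp `[n.+2%:R^-1, 1%R]%classic) @[n --> \oo] -->
    density lambda mp pp `]0%R, 1%R]%classic.
  apply: H => // m n mn; apply/subsetPset => v /=;
    rewrite !in_itv/= => /andP[h ->].
  by rewrite andbT; apply: le_trans h; rewrite lef_pV2 ?posrE// ler_nat.
rewrite -(cvg_lim _ H)//; apply: lime_le; first by apply/cvg_ex; eexists;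
  exact: H.
apply: nearW => n; rewrite /density integral_powR//; last 2 first.
- by rewrite invf_lt1// ltr1n.
- by rewrite gt_eqF.
rewrite lee_fin -[leRHS]mul1r ler_wpM2r ?invr_ge0// ltW//.
by rewrite powR1 ltrBlDr ltrDl powR_gt0// invr_gt0.
Qed.

Lemma integral_powR_nearoo p : p < -1 ->
  (\int[lambda]_(v in `]1%R, +oo[) (v `^ p)%:E < +oo)%E.
Proof.
move=> p1; have p0 : 0 < - (p + 1) by lra.
have mp : measurable_fun [set: R] (fun v : R =>
  v `^ p) by exact: measurable_powR.
have pp v : 0 <= v `^ p :> R by exact: powR_ge0.
rewrite integral_itv_obnd_cbnd; last exact/measurable_EFinP/measurable_funTS.
rewrite -[ltLHS]/(density lambda mp pp `[1%R, +oo[%classic).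
have U : \bigcup_n `[1%R, n.+2%:R]%classic = `[1%R, +oo[%classic :> set R.
  apply/seteqP; split => v /=.
    by move=> [n _] /=; rewrite !in_itv/= => /andP[-> _].
  rewrite in_itv/= andbT => v1; exists (Num.truncn v) => //=.
  rewrite in_itv/= v1; apply: (le_trans (ltW (truncnS_gt _))).
  by rewrite ler_nat.
apply: (@le_lt_trans _ _ (- (p + 1))^-1%:E); last exact: ltry.
have H := @nondecreasing_cvg_mu _ _ _ (density lambda mp pp)
  (fun n => `[1%R, n.+2%:R]%classic); rewrite /= U in H.
have {}H : (density lambda mp pp `[1%R, n.+2%:R]%classic) @[n --> \oo] -->
    density lambda mp pp `[1%R, +oo[%classic.
  apply: H => // m n mn; apply/subsetPset => v /=;
    rewrite !in_itv/= => /andP[->] h /=.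
  by apply: (le_trans h); rewrite ler_nat.
rewrite -(cvg_lim _ H)//; apply: lime_le; first by apply/cvg_ex; eexists;
  exact: H.
apply: nearW => n; rewrite /density integral_powR ?ltr1n//;
  last by rewrite lt_eqF.
rewrite lee_fin powR1 -mulrNN -invrN -[leRHS]mul1r ler_wpM2r//.
by rewrite invr_ge0 ltW.
Qed.

Lemma ge0_lambdaZl (f : R -> R) (k : R) : measurable_fun [set: R] f ->
  (forall v, 0 <= f v) -> 0 <= k ->
  (\int[lambda]_(v in `]0%R, +oo[) (k%:E * (f v)%:E) =
   k%:E * \int[lambda]_(v in `]0%R, +oo[) (f v)%:E)%E.
Proof.
move=> mf f0 k0; apply: ge0_integralZl => //.
- exact/measurable_EFinP/measurable_funTS.
- by move=> v _; rewrite lee_fin.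
Qed.

Section stable_density.
Variable a : R.
Hypotheses (a1 : 1 < a) (a2 : a < 2).
Let D : set R := `]0, +oo[.
Let mD : measurable D. Proof. exact: measurable_itv. Qed.

(** Near 0 the integrand is [v^(1 - a)], integrable as [a < 2]; beyond 1 it is [v^(- a)], integrable
    as [a > 1]. *)
Lemma min_powR_integrable :
  lambda.-integrable D (fun v => (Num.min v (v ^+ 2) * v `^ (- a - 1))%:E).
Proof.
apply/integrableP; split.
  apply/measurable_EFinP; apply: measurable_funTS; apply: measurable_funM => //.
  exact: measurable_minr.
rewrite /D (_ : `]0%R, +oo[%classic = `]0%R, 1%R] `|` `]1%R, +oo[); last first.
  apply/seteqP; split => v /=; rewrite !in_itv/= !andbT.
    by move=> v0; have [v1|v1] := leP v 1; [left; rewrite v0|right].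
  by case; lra.
rewrite ge0_integral_setU//=; last 2 first.
- apply/measurable_funTS/measurable_EFinP; apply: measurableT_comp => //.
  by apply: measurable_funM => //; exact: measurable_minr.
- by apply/disj_setPS => v /= []; rewrite !in_itv/= andbT =>
  /andP[_ /le_lt_trans h] /h; rewrite ltxx.
apply: lte_add_pinfty.
  have h : -1 < 1 - a by rewrite ltrBrDr addrC ltrBlDr; exact: a2.
  apply: le_lt_trans (integral_powR_near0 h); rewrite le_eqVlt; apply/orP;
    left; apply/eqP.
  apply: eq_integral => v; rewrite inE/= in_itv/= => /andP[v0 v1]; congr EFin.
  rewrite ger0_norm ?mulr_ge0 ?powR_ge0 ?le_min ?sqr_ge0 ?(ltW v0)//.
  rewrite min_r; last by rewrite expr2 ler_piMl// ltW.
  rewrite -powR_mulrn ?ltW// -powRD; last by apply/implyP => _; rewrite gt_eqF.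
  by congr (_ `^ _); ring.
have h : - a < -1 by rewrite ltrN2.
apply: le_lt_trans (integral_powR_nearoo h); rewrite le_eqVlt; apply/orP; left;
  apply/eqP.
apply: eq_integral => v; rewrite inE/= in_itv/= andbT => v1; congr EFin.
have v0 : 0 < v by lra.
rewrite ger0_norm ?mulr_ge0 ?powR_ge0 ?le_min ?sqr_ge0 ?(ltW v0)//.
rewrite min_l; last by rewrite expr2 ler_peMl// ltW.
rewrite -[X in X * _]powRr1 ?ltW// -powRD; last by apply/implyP => _;
  rewrite gt_eqF.
by congr (_ `^ _); ring.
Qed.

Lemma psi_powR_integrable b : 0 <= b ->
  lambda.-integrable D (fun v => (psi (b * v) * v `^ (- a - 1))%:E).
Proof.
move=> b0; apply: (le_integrable _ _ _ (integrableZl _ (b + b ^+ 2)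
  min_powR_integrable)) => //.
  apply/measurable_EFinP; apply: measurable_funTS; apply: measurable_funM => //.
  by apply: measurableT_comp; [exact: measurable_psi|exact: measurable_funM].
move=> v; rewrite /D/= in_itv/= andbT => v0.
have p0 : 0 <= v `^ (- a - 1) by exact: powR_ge0.
have m0 : 0 <= Num.min v (v ^+ 2) by rewrite le_min (ltW v0) sqr_ge0.
rewrite lee_fin !ger0_norm ?mulr_ge0 ?psi_ge0 ?addr_ge0 ?sqr_ge0//.
  rewrite mulrA ler_wpM2r//.
  by apply: psi_le_min => //; [exact: ltW|exact/mulr_ge0/ltW].
Qed.

(** The value at [b = 1] of the exponent of the measure [v^(-a-1) dv] on the positive half line. *)
Definition stable_const := \int[lambda]_(v in D) (psi v * v `^ (- a - 1)).

(** Writing [v^(-a-1) = b^(a+1) (b v)^(-a-1)] and substituting [b v] for [v] costs a factor [1/b],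
    which leaves [b^a]. *)
Lemma psi_powR_scale b : 0 < b ->
  (\int[lambda]_(v in D) (psi (b * v) * v `^ (- a - 1))%:E)%E =
  (b `^ a * stable_const)%:E.
Proof.
move=> b0.
have i1 := psi_powR_integrable ler01.
rewrite EFinM /stable_const /Rintegral fineK; last first.
  under eq_integral do rewrite -[X in psi X]mul1r.
  exact: integrable_fin_num.
transitivity (\int[lambda]_(v in D) ((b `^ (a + 1))%:E *
  (psi (b * v) * (b * v) `^ (- a - 1))%:E))%E.
  apply: eq_integral => v; rewrite inE/D/= in_itv/= andbT => v0;
    rewrite -EFinM; congr EFin.
  rewrite powRM ?ltW// mulrCA [X in _ = _ * X]mulrA -powRD; last first.
    by apply/implyP => _; rewrite gt_eqF.
  have -> : a + 1 + (- a - 1) = 0 by ring.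
  by rewrite powRr0 mul1r.
have mf : measurable_fun [set: R] (fun v => psi (b * v) * (b * v) `^ (- a - 1)).
  apply: measurable_funM.
    by apply: measurableT_comp; [exact: measurable_psi|exact: measurable_funM].
  apply: (measurableT_comp (f := fun v : R => v `^ (- a - 1))) => //;
    exact: measurable_funM.
have f0 v : 0 <= psi (b * v) * (b * v) `^ (- a - 1).
  by rewrite mulr_ge0 ?psi_ge0 ?powR_ge0.
apply: (etrans (ge0_lambdaZl mf f0 (powR_ge0 b (a + 1)))).
have mg : measurable_fun [set: R] (fun v => (psi v * v `^ (- a - 1))%:E).
  by apply/measurable_EFinP; apply: measurable_funM => //;
    exact: measurable_psi.
have g0 v : (0 <= (psi v * v `^ (- a - 1))%:E)%E.
  by rewrite lee_fin mulr_ge0 ?psi_ge0 ?powR_ge0.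
rewrite [X in (_ * X)%E](integral_scale b0 mg g0).
rewrite muleA -EFinM; congr (_%:E * _)%E.
rewrite powRD; last by apply/implyP => _; rewrite gt_eqF.
by rewrite powRr1 ?ltW// mulfK// gt_eqF.
Qed.

(** A null integral would make [h] vanish almost everywhere on a set of infinite measure. *)
Lemma Rintegral_gt0 (h : R -> R) : lambda.-integrable D (EFin \o h) ->
  (forall v, 0 < v -> 0 < h v) -> 0 < \int[lambda]_(v in D) h v.
Proof.
move=> ih h0; rewrite lt_def Rintegral_ge0 ?andbT; last first.
  by move=> v; rewrite /D/= in_itv/= andbT => /h0/ltW.
apply/eqP => I0.
have : (\int[lambda]_(v in D) `|(h v)%:E| = 0)%E.
  transitivity (\int[lambda]_(v in D) (h v)%:E)%E.
    apply: eq_integral => v; rewrite inE/D/= in_itv/= andbT => v0.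
    by rewrite /= ger0_norm// ltW// h0.
  rewrite -[LHS]fineK; last exact: integrable_fin_num.
  by congr EFin.
move/(ae_eq_integral_abs lambda mD (measurable_int _ ih)) => [N [mN N0 subN]].
have : (lambda D <= lambda N)%E.
  apply: le_measure; rewrite ?inE//.
  apply: subset_trans subN => v Dv /= /(_ Dv) [h00].
  by have := h0 v; rewrite h00 ltxx; move: Dv;
    rewrite /D/= in_itv/= andbT => v0 /(_ v0).
by rewrite N0 /D lebesgue_measure_itv/= ltry.
Qed.

Lemma stable_const_gt0 : 0 < stable_const.
Proof.
apply: Rintegral_gt0.
  have := psi_powR_integrable ler01; apply: eq_integrable => // v _.
  by rewrite /= mul1r.
by move=> v v0; rewrite mulr_gt0 ?powR_gt0// psi_gt0// gt_eqF.
Qed.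

(** The real-valued integral is 0 by convention when the extended one is infinite, so positivity
    requires integrability. It comes from [v ^ 2 exp (- v) <= min v (v ^ 2)], multiplied by
    [v^(-a-1)]. *)
Lemma euler_gamma_gt0 : 0 < euler_gamma (2 - a).
Proof.
rewrite /euler_gamma; apply: Rintegral_gt0; last first.
  by move=> v v0; rewrite mulr_gt0 ?powR_gt0// expR_gt0.
apply: (le_integrable _ _ _ min_powR_integrable) => //.
  apply/measurable_EFinP; apply: measurable_funTS; apply: measurable_funM.
    exact: measurable_powR.
  by apply: measurableT_comp => //; exact: oppr_measurable.
move=> v; rewrite /D/= in_itv/= andbT => v0.
have m0 : 0 <= Num.min v (v ^+ 2) by rewrite le_min (ltW v0) sqr_ge0.
rewrite lee_fin !ger0_norm ?mulr_ge0 ?powR_ge0 ?expR_ge0 ?(ltW v0) ?m0//.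
have -> : v `^ (2 - a - 1) = v ^+ 2 * v `^ (- a - 1).
  rewrite -powR_mulrn ?ltW// -powRD; last by apply/implyP => _; rewrite gt_eqF.
  by congr (_ `^ _); ring.
rewrite mulrAC ler_wpM2r ?powR_ge0// le_min; apply/andP; split; last first.
  by rewrite ler_piMr ?sqr_ge0// expR_le1 oppr_le0 ltW.
rewrite expr2 -mulrA ler_piMr ?(ltW v0)//.
rewrite expRN -[leRHS]mul1r -ler_pdivlMr ?invr_gt0 ?expR_gt0// invrK mul1r.
by have := expR_ge1Dx v; lra.
Qed.

End stable_density.

Lemma c_stable_gt0 (a : R) : 1 < a -> a <= 2 -> 0 < c_stable a.
Proof.
rewrite /c_stable => a1; case: eqVneq => [_ _|a2 a3]; first by rewrite invr_gt0.
by rewrite divr_gt0 ?euler_gamma_gt0 ?mulr_gt0 ?subr_gt0 ?lt_neqAle ?a2//; lra.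
Qed.

End power_integrals.


(** * Tuples, and the stable Levy measure carried by them *)

Section tuples.
Context {R : realType} {n : nat}.

Lemma measurable_dot (u : 'I_n -> R) : measurable_fun [set: n.-tuple R] (dot u).
Proof.
apply: measurable_sum => i; apply: measurable_funM => //;
  exact: measurable_tnth.
Qed.

Lemma measurable_norm2 : measurable_fun [set: n.-tuple R] (@norm2 R n).
Proof.
rewrite /norm2; apply: (@measurableT_comp _ _ _ _ _ _ (Num.sqrt : R -> R)).
  by apply: continuous_measurable_fun; exact: sqrt_continuous.
apply: measurable_sum => i; apply: measurable_funX; exact: measurable_tnth.
Qed.

Lemma norm2_ge0 (y : n.-tuple R) : 0 <= norm2 y.
Proof. exact: sqrtr_ge0. Qed.

Lemma tnth_le_norm2 (y : n.-tuple R) i : `|tnth y i| <= norm2 y.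
Proof.
rewrite -sqrtr_sqr ler_wsqrtr// (bigD1 i)//= lerDl sumr_ge0// => j _.
exact: sqr_ge0.
Qed.

End tuples.

Section stable_levy_measure.
Context {R : realType}.
Variables a gam : R.
Hypotheses (a1 : 1 < a) (a2 : a < 2) (gam0 : 0 < gam).
Local Notation lambda := (@lebesgue_measure R).
Let D : set R := `]0, +oo[.

Definition stable_pdf (v : R) : R := gam * v `^ (- a - 1) * \1_D v.

Let mpdf : measurable_fun [set: R] stable_pdf.
Proof.
apply: measurable_funM; last by apply: measurable_indic; exact: measurable_itv.
by apply: measurable_funM => //; exact: measurable_powR.
Qed.

Let pdf0 v : 0 <= stable_pdf v.
Proof. by rewrite !mulr_ge0 ?powR_ge0// ltW. Qed.

Let mtup : measurable_fun [set: measurableTypeR R]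
  (fun v : measurableTypeR R => [tuple (v : R)]).
Proof.
apply/measurable_fun_tnthP => i; rewrite (_ : _ \o _ = id)//.
by apply/funext => v; rewrite (ord1 i).
Qed.

(** Kept transparent, so that its values unfold to a pushforward. *)
Definition stable_levy : {measure set (1.-tuple R) -> \bar R}.
Proof.
by refine (pushforward (density lambda mpdf pdf0) (fun v : R => [tuple v]));
  exact: mtup.
Defined.

Lemma stable_levyE B : measurable B ->
  stable_levy B = (\int[lambda]_(v in `]0%R, +oo[ `&` [set v : R | B [tuple v]])
    (gam * v `^ (- a - 1))%:E)%E.
Proof.
move=> mB; rewrite setIC integral_mkcondr epatch_indic.
rewrite -[LHS]/(\int[lambda]_(v in [set v : R | B [tuple v]]) (stable_pdf
  v)%:E)%E.
by apply: eq_integral => v _; rewrite /stable_pdf EFinM.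
Qed.

Lemma integral_stable_levy (g : 1.-tuple R -> R) :
  measurable_fun [set: 1.-tuple R] g -> (forall y, 0 <= g y) ->
  (\int[stable_levy]_y (g y)%:E =
   gam%:E * \int[lambda]_(v in `]0%R,
     +oo[) (g [tuple v] * v `^ (- a - 1))%:E)%E.
Proof.
move=> mg g0; have mgt : measurable_fun [set: R] (fun v => g [tuple v]).
  by apply: (measurableT_comp mg); exact: mtup.
have mgE : measurable_fun [set: 1.-tuple R] (EFin \o g) by
  exact/measurable_EFinP.
have gE : {in [set: 1.-tuple R], forall y, 0 <= (EFin \o g) y}%E.
  by move=> y _; rewrite lee_fin.
apply: (etrans (ge0_integral_pushforward mtup (density lambda mpdf pdf0)
  measurableT mgE gE)).
rewrite preimage_setT ge0_integral_density//; last 2 first.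
- by apply/measurable_EFinP.
- by move=> v; rewrite lee_fin.
rewrite -(ge0_lambdaZl _ _ (ltW gam0)); last 2 first.
- by apply: measurable_funM => //; exact: measurable_powR.
- by move=> v; rewrite mulr_ge0 ?powR_ge0.
rewrite [RHS]integral_mkcond epatch_indic.
apply: eq_integral => v _; rewrite /stable_pdf /= -!EFinM; congr EFin; ring.
Qed.

End stable_levy_measure.

Section stable_from_exponent.
Context {d : measure_display} {T : measurableType d} {R : realType}.
Variables (P : probability T R) (a c : R) (Y : R -> T -> R).
Hypotheses (a1 : 1 < a) (a2 : a < 2) (c0 : 0 < c).
Hypothesis Yc : laplace_exponent P Y (fun b => c * b `^ a).
Local Notation lambda := (@lebesgue_measure R).

Lemma stable_characteristics :
  exists (gam : R) (nu : {measure set (1.-tuple R) -> \bar R}),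
      [/\ 0 < gam,
          forall B, measurable B ->
            (nu B = \int[lambda]_(v in
                       `]0%R, +oo[ `&` [set v : R | B [tuple v]])
                       (gam * v `^ (- a - 1))%:E)%E &
          levy_characteristics P (fun _ : 'I_1 => Y) 0 nu].
Proof.
have K0 := stable_const_gt0 a1 a2.
have g0 : 0 < c / stable_const a by rewrite divr_gt0.
(* The exponent of [gam v^(-a-1) dv] is [gam * stable_const a * b^a]; this [gam] makes the
   coefficient [c]. *)
exists (c / stable_const a), (stable_levy a g0); split => //.
  exact: stable_levyE.
have mtnth : measurable_fun [set: 1.-tuple R] (fun y => tnth y ord0).
  exact: measurable_tnth.
split.
- split; first exact: trmx0.
  by move=> u; rewrite /qform big1// => i _; rewrite big1// => j _;
    rewrite mxE !mul0r.
- rewrite stable_levyE; last first.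
    rewrite (_ : [set _] = (fun y : 1.-tuple R => tnth y ord0) @^-1` [set 0]).
      by rewrite -[X in measurable X]setTI; exact: mtnth.
    apply/seteqP; split => y /=; first by move=> ->; rewrite tnth_mktuple.
    by move=> y0; apply: eq_from_tnth => i; rewrite (ord1 i) y0 tnth_mktuple.
  rewrite (_ : _ `&` _ = set0) ?integral_set0//.
  apply/seteqP; split => v //=; rewrite in_itv/= andbT => -[v0].
  move/(congr1 (fun y : 1.-tuple R => tnth y ord0));
    rewrite tnth_mktuple => v00.
  by move: v0; rewrite -v00 ltxx.
- rewrite stable_levyE; last first.
    rewrite (_ : [set _ | _] = (fun y : 1.-tuple R => tnth y ord0) @^-1` `]-oo,
      0[).
      by rewrite -[X in measurable X]setTI; exact: mtnth.
    apply/seteqP; split => y /=; rewrite in_itv/=; first by move=> [i];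
      rewrite (ord1 i).
    by exists ord0.
  rewrite (_ : _ `&` _ = set0) ?integral_set0//.
  apply/seteqP; split => v //=; rewrite in_itv/= andbT => -[v0] [i].
  by rewrite (ord1 i) => /lt_trans /(_ v0); rewrite ltxx.
- rewrite integral_stable_levy; last 2 first.
  + by apply: measurable_minr; [exact: measurable_norm2|
      apply: measurable_funX; exact: measurable_norm2].
  + by move=> y; rewrite le_min norm2_ge0 sqr_ge0.
  have n1 (v : R) : 0 < v -> norm2 [tuple v] = v.
    by move=> v0; rewrite /norm2 big_ord1 sqrtr_sqr ger0_norm// ltW.
  under eq_integral => v.
    rewrite inE/= in_itv/= andbT => v0; rewrite n1//.
    over.
  rewrite lte_mul_pinfty ?lee_fin ?ltW//.
  by apply: integrable_lty (min_powR_integrable a1 a2).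
- move=> t b t0 b0.
  have -> : (fun w : T => expR (- \sum_(i < 1) b i * Y t w)) =
      (fun w => expR (- b ord0 * Y t w)).
    by apply/funext => w; rewrite big_ord1 mulNr.
  rewrite Yc//; congr (expR (t * _))%:E.
  have -> : qform (0 : 'M[R]_1) b = 0.
    by rewrite /qform big1// => i _; rewrite big1// => j _; rewrite mxE !mul0r.
  rewrite mulr0 add0r /Rintegral.
  rewrite (_ : (fun y : 1.-tuple R => (expR (- dot b y) - 1 + dot b y)%:E) =
    (fun y => (psi (dot b y))%:E))//.
  rewrite integral_stable_levy; last 2 first.
  + by apply: measurableT_comp; [exact: measurable_psi|exact: measurable_dot].
  + by move=> y; exact: psi_ge0.
  under eq_integral do rewrite /dot big_ord1.
  (* Scaling needs [b > 0]. At [b = 0] both sides vanish, the power because its exponent is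
     nonzero. *)
  have := b0 ord0; rewrite le_eqVlt => /predU1P[<-|b00].
    rewrite powR0 ?mulr0; last by rewrite gt_eqF// (lt_trans _ a1).
    under eq_integral do rewrite mul0r psi0 mul0r.
    by rewrite integral0 mule0.
  rewrite psi_powR_scale// -EFinM /=.
  by field; rewrite gt_eqF.
Qed.

End stable_from_exponent.


(** * Linear combinations of the coordinates of a Levy martingale *)

Section levy_combination.
Context {d : measure_display} {T : measurableType d} {R : realType}.
Variables (P : probability T R) (Z1 Z2 : R -> T -> R) (g1 g2 : R).
Let X := vec2 Z1 Z2.
Let Y : R -> T -> R := fun t w => g1 * Z1 t w + g2 * Z2 t w.

(** The increments of [Y] are the images of those of [X] under this fixed linear map, so their
    independence and stationarity are those of [X] on preimages. *)
Let combine (y : 2.-tuple R) : 1.-tuple R :=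
  [tuple g1 * tnth y ord0 + g2 * tnth y ord_max | i < 1].

Let mcombine : measurable_fun [set: 2.-tuple R] combine.
Proof.
apply/measurable_fun_tnthP => i.
rewrite (_ : _ \o _ = fun y => g1 * tnth y ord0 + g2 * tnth y ord_max).
  by apply: measurable_funD; apply: measurable_funM => //;
    exact: measurable_tnth.
by apply/funext => y; rewrite /= tnth_mktuple.
Qed.

Let increment_combine s t w : increment (fun _ : 'I_1 =>
  Y) s t w = combine (increment X s t w).
Proof.
apply: eq_from_tnth => i; rewrite !tnth_mktuple /Y /X /vec2 /=; ring.
Qed.

Lemma gen_sigma_measurable_fun (I : Type) (D : set I) (V : I -> T -> R) i :
  D i -> measurable_fun [set: g_sigma_algebraType
    [set A | exists i, D i /\ exists B : set R,
      measurable B /\ A = V i @^-1` B]]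
    (V i).
Proof.
move=> Di _ B mB; rewrite setTI; apply: sub_sigma_algebra.
by exists i; split => //; exists B.
Qed.

Let filtration_sub s : natural_filtration (fun _ : 'I_1 =>
  Y) s `<=` natural_filtration X s.
Proof.
apply: smallest_sub; first exact: smallest_sigma_algebra.
move=> A /= [[i t] [/= st [B [mB ->]]]].
have m1 : measurable_fun [set: g_sigma_algebraType [set A | exists i : 'I_2 *
  R, (0 <= i.2 <= s) /\ exists B : set R,
  measurable B /\ A = X i.1 i.2 @^-1` B]] (Y t).
  apply: measurable_funD; apply: measurable_funM => //.
    by have := @gen_sigma_measurable_fun _ [set ir : 'I_2 * R | 0 <= ir.2 <= s]
      (fun ir => X ir.1 ir.2) (ord0, t) st.
  by have := @gen_sigma_measurable_fun _ [set ir : 'I_2 * R | 0 <= ir.2 <= s]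
    (fun ir => X ir.1 ir.2) (ord_max, t) st.
by have := m1 measurableT B mB; rewrite setTI.
Qed.

Lemma natural_filtration_measurable n (V : 'I_n -> R -> T -> R) s :
  (forall i t, 0 <= t -> measurable_fun [set: T] (V i t)) ->
  natural_filtration V s `<=` measurable.
Proof.
move=> mV; apply: smallest_sub; first exact: sigma_algebra_measurable.
move=> A /= [[i t] [/= /andP[t0 _] [B [mB ->]]]].
by rewrite -[X in measurable X]setTI; exact: mV.
Qed.

Let levy_combine : levy_process P X -> levy_process P (fun _ : 'I_1 => Y).
Proof.
move=> [mX X0 indX statX cadX].
have m1 t : 0 <= t -> measurable_fun [set: T] (Z1 t) by exact: (mX ord0).
have m2 t : 0 <= t -> measurable_fun [set: T] (Z2 t) by exact: (mX ord_max).
split.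
- by move=> _ t t0; apply: measurable_funD; apply: measurable_funM => //;
  [exact: m1|exact: m2].
- apply: filterS X0 => w w0 _.
  have := w0 ord0; have := w0 ord_max; rewrite /X /vec2/= /Y => -> ->.
  by rewrite !mulr0 addr0.
- move=> s t s0 st A B FA mB.
  have E : increment (fun _ : 'I_1 => Y) s t @^-1` B =
     increment X s t @^-1` (combine @^-1` B).
    by apply/funext => w; rewrite /preimage/= increment_combine.
  rewrite E; apply: indX => //; first exact: filtration_sub.
  by rewrite -[X in measurable X]setTI; exact: mcombine.
- move=> s h s0 h0 B mB.
  have E s' t : increment (fun _ : 'I_1 => Y) s' t @^-1` B =
     increment X s' t @^-1` (combine @^-1` B).
    by apply/funext => w; rewrite /preimage/= increment_combine.
  rewrite !E; apply: statX => //.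
  by rewrite -[X in measurable X]setTI; exact: mcombine.
- apply: filterS cadX => w cw _.
  have [r1 l1] := cw ord0; have [r2 l2] := cw ord_max.
  split => t t0.
    apply: cvgD; apply: cvgMr; [exact: r1|exact: r2].
  by apply: is_cvgD; apply: is_cvgMr; [exact: l1|exact: l2].
Qed.

(** The natural filtration of [Y] is contained in that of [X], so the martingale identities of both
    coordinates hold on its events and combine linearly. *)
Lemma levy_martingale_combine : levy_martingale P X ->
  levy_martingale P (fun _ : 'I_1 => Y).
Proof.
move=> [LX MX]; have LY := levy_combine LX; split => // i {i}.
have [a1 i1 e1] := MX ord0; have [a2 i2 e2] := MX ord_max.
have iY t : 0 <= t -> P.-integrable [set: T] (EFin \o Y t).
  move=> t0; apply: (eq_integrable measurableT
    (fun w => (g1%:E * (Z1 t w)%:E + g2%:E * (Z2 t w)%:E)%E)) => //.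
  apply: integrableD => //; apply: integrableZl => //; [exact: i1|exact: i2].
split => //.
- move=> t t0 B mB; apply: sub_sigma_algebra.
  by exists (ord0, t); split => /=; [rewrite lexx t0|exists B].
- move=> s t s0 st A FA; have FX := filtration_sub FA.
  have mA : measurable A by apply: natural_filtration_measurable FX; case: LX.
  have E u : 0 <= u -> (\int[P]_(w in A) (Y u w)%:E =
     g1%:E * \int[P]_(w in A) (Z1 u w)%:E + g2%:E * \int[P]_(w in A) (Z2 u
       w)%:E)%E.
    move=> u0.
    have j1 : P.-integrable A (EFin \o Z1 u) by apply: (integrableS
      measurableT) => //; exact: i1.
    have j2 : P.-integrable A (EFin \o Z2 u) by apply: (integrableS
      measurableT) => //; exact: i2.
    rewrite -!integralZl//.
    by rewrite -integralD//; apply: integrableZl.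
  by rewrite !E ?(le_trans s0 st)// (e1 s t s0 st A FX) (e2 s t s0 st A FX).
Qed.

End levy_combination.

(** * Laplace transforms of independent processes *)

Section independence.
Context {d : measure_display} {T : measurableType d} {R : realType}.
Variable P : probability T R.

Lemma ge0_integral_indep (X1 X2 : T -> R) (f1 f2 : R -> R) :
  measurable_fun [set: T] X1 -> measurable_fun [set: T] X2 ->
  measurable_fun [set: R] f1 -> measurable_fun [set: R] f2 ->
  (forall x, 0 <= f1 x) -> (forall x, 0 <= f2 x) ->
  (forall A B, measurable A -> measurable B ->
     P (X1 @^-1` A `&` X2 @^-1` B) = (P (X1 @^-1` A) * P (X2 @^-1` B))%E) ->
  (\int[P]_w (f1 (X1 w) * f2 (X2 w))%:E =
   \int[P]_w (f1 (X1 w))%:E * \int[P]_w (f2 (X2 w))%:E)%E.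
Proof.
move=> mX1 mX2 mf1 mf2 f10 f20 indep.
pose V1 : {RV P >-> R} := HB.pack X1 (isMeasurableFun.Build _ _ _ _ _ mX1).
pose V2 : {RV P >-> R} := HB.pack X2 (isMeasurableFun.Build _ _ _ _ _ mX2).
have mpair : measurable_fun [set: T] (fun w => (X1 w, X2 w)).
  exact: measurable_fun_pair.
have mF : measurable_fun [set: R * R] (fun z : R * R => (f1 z.1 * f2 z.2)%:E).
  apply/measurable_EFinP; apply: measurable_funM.
    exact: (measurableT_comp mf1).
  exact: (measurableT_comp mf2).
have F0 (z : R * R) : (0 <= (f1 z.1 * f2 z.2)%:E)%E by rewrite lee_fin mulr_ge0.
transitivity (\int[pushforward P (fun w => (X1 w,
  X2 w))]_z (f1 z.1 * f2 z.2)%:E)%E.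
  by rewrite (ge0_integral_pushforward mpair).
(* Independence makes the joint law agree with the product law on rectangles, hence everywhere;
   Tonelli then separates the factors. *)
transitivity (\int[distribution P V1 \x distribution P V2]_z (f1 z.1 * f2
  z.2)%:E)%E.
  apply: eq_measure_integral => A mA _; apply/esym.
  by apply: (product_measure_unique _ mA) => B C mB mC; exact: indep.
have inner x : (\int[distribution P V2]_y (f1 x * f2 y)%:E =
    (f1 x)%:E * \int[P]_w (f2 (X2 w))%:E)%E.
  under eq_integral do rewrite EFinM.
  rewrite ge0_integralZl//; last 3 first.
  - exact/measurable_EFinP.
  - by move=> y _; rewrite lee_fin.
  - by rewrite lee_fin.
  by congr (_ * _)%E; rewrite ge0_integral_distribution//;
    exact/measurable_EFinP.
rewrite fubini_tonelli1//= /fubini_F/=.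
under eq_integral do rewrite inner.
rewrite ge0_integralZr//; last 3 first.
- exact/measurable_EFinP.
- by move=> x _; rewrite lee_fin.
- by apply: integral_ge0 => w _; rewrite lee_fin.
congr (_ * _)%E.
by rewrite ge0_integral_distribution//; exact/measurable_EFinP.
Qed.

Lemma laplace_indep (Y1 Y2 : R -> T -> R) (K1 K2 : R -> R) t b1 b2 :
  independent_processes P Y1 Y2 ->
  laplace_exponent P Y1 K1 -> laplace_exponent P Y2 K2 ->
  0 <= t -> measurable_fun [set: T] (Y1 t) -> measurable_fun [set: T] (Y2 t) ->
  0 <= b1 -> 0 <= b2 ->
  ('E_P[fun w => expR (- (b1 * Y1 t w + b2 * Y2 t w))] =
   (expR (t * (K1 b1 + K2 b2)))%:E)%E.
Proof.
move=> ind l1 l2 t0 m1 m2 b10 b20.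
rewrite mulrDr expRD EFinM -(l1 t b1)// -(l2 t b2)// unlock.
under eq_integral do rewrite opprD expRD -!mulNr.
apply: (ge0_integral_indep (f1 := fun x => expR (- b1 * x)) (f2 := fun x =>
  expR (- b2 * x))) => //.
- apply: measurableT_comp => //; exact: measurable_funM.
- apply: measurableT_comp => //; exact: measurable_funM.
- move=> A B mA mB; apply: ind; apply: sub_sigma_algebra; exists t; split => //.
    by exists A.
  by exists B.
Qed.

End independence.

(** * Exponents of linear growth force finite variation *)

Section finite_variation.
Context {d : measure_display} {T : measurableType d} {R : realType}.
Variable P : probability T R.

(* Chernoff: [P (V + c <= - e) <= exp (- b e)] for all [b >= 0]. *)
Lemma laplace_ge_ae (V : T -> R) (c : R) : measurable_fun [set: T] V ->
  (forall b, 0 <= b -> ('E_P[fun w => expR (- b * V w)] <= (expR (b *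
    c))%:E)%E) ->
  {ae P, forall w, - c <= V w}.
Proof.
move=> mV bV.
pose N n := [set w | V w <= - c - n.+1%:R^-1].
have mN n : measurable (N n).
  rewrite (_ : N n = V @^-1` `]-oo, - c - n.+1%:R^-1]); last first.
    by apply/seteqP; split => w; rewrite /N /= in_itv.
  by rewrite -[X in measurable X]setTI; exact: mV.
suff N0 n : P (N n) = 0%E.
  have [M [mM M0 NM]] : P.-negligible (\bigcup_n N n).
    by apply: negligible_bigcup => n; apply/negligibleP; [exact: mN|exact: N0].
  exists M; split => // w /= /negP; rewrite -ltNge => Vc; apply: NM.
  exists (Num.truncn (- c - V w)^-1) => //; rewrite /N /=.
  have h : 0 < - c - V w by rewrite subr_gt0.
  rewrite lerBrDr -lerBrDl invf_ple ?posrE//.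
  by rewrite ltW// truncnS_gt.
have Pfin : P (N n) \is a fin_num by exact: fin_num_measure.
have bound k : fine (P (N n)) <= expR (- (k%:R * n.+1%:R^-1)).
  rewrite -lee_fin fineK//.
  set b : R := k%:R; have b0 : 0 <= b by [].
  have H : ((expR (b * c + b / n.+1%:R))%:E * P (N n) <= (expR (b * c))%:E)%E.
    apply: le_trans (bV b b0); rewrite unlock -integral_cst//.
    have mE : measurable_fun [set: T] (fun w => (expR (- b * V w))%:E).
      apply/measurable_EFinP; apply: measurableT_comp => //;
        exact: measurable_funM.
    apply: (@le_trans _ _ (\int[P]_(w in N n) (expR (- b * V w))%:E)%E).
      apply: ge0_le_integral => //.
      - by move=> w _; rewrite lee_fin expR_ge0.
      - exact: measurable_funTS.
      - move=> w; rewrite /N/= => Vw;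
        rewrite lee_fin ler_expR mulNr -mulrN -mulrDr.
        by apply: ler_wpM2l => //; rewrite lerNr opprD.
    exact: ge0_subset_integral.
  rewrite -(@lee_pmul2l _ (expR (b * c + b / n.+1%:R))%:E) ?lte_fin ?expR_gt0//.
  by apply: (le_trans H); rewrite -EFinM lee_fin -expRD ler_expR addrK.
have : fine (P (N n)) <= 0.
  have n0 : 0 < n.+1%:R^-1 :> R by rewrite invr_gt0.
  have := expRNM_cvg0 n0 => h; rewrite -(cvg_lim _ h)//.
  apply: limr_ge; first by apply/cvg_ex; eexists; exact: h.
  by apply: nearW => k; exact: bound.
rewrite le_eqVlt ltNge fine_ge0// orbF => /eqP h.
by rewrite -[LHS]fineK// h.
Qed.

(** If [f t < f s], right continuity keeps [f] below the midpoint just after [t] and above it just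
    after [s]; rationals chosen there contradict monotonicity. Almost sure statements can thus be
    made for countably many pairs of times only. *)
Lemma nondecreasing_right_continuous_rat (f : R -> R) :
  (forall t, 0 <= t -> f s @[s --> t^'+] --> f t) ->
  (forall p q : rat, 0 <= p -> p <= q -> f (ratr p) <= f (ratr q)) ->
  forall s t, 0 <= s -> s <= t -> f s <= f t.
Proof.
move=> rc fq s t s0; rewrite le_eqVlt => /predU1P[->//|st].
have t0 : 0 <= t by rewrite (le_trans s0)// ltW.
rewrite leNgt; apply/negP => fts.
set m := (f s + f t) / 2.
have [mt ms] : f t < m /\ m < f s by rewrite /m; split; lra.
have Ht : \forall u \near t^'+, f u < m by exact: (cvgr_lt (f t) (rc t t0)).
have Hs : \forall u \near s^'+, m < f u by exact: (cvgr_gt (f s) (rc s s0)).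
have [e1 /= e10 He1] := Ht; have [e2 /= e20 He2] := Hs.
have /rat_in_itvoo[q /itvP hq] : t < t + e1 by rewrite ltrDl.
have /rat_in_itvoo[p] : s < Num.min t (s + e2) by rewrite lt_min st ltrDl.
rewrite in_itv/= lt_min => /and3P[p1 p2 p3].
have h1 : f (ratr q) < m.
  apply: He1 => /=; last by rewrite hq.
  rewrite ltr0_norm ?opprB ?subr_lt0 ?hq// ltrBlDl hq//.
have h2 : m < f (ratr p).
  by apply: He2 => //=; rewrite ltr0_norm ?opprB ?subr_lt0// ltrBlDl.
have p0 : 0 <= p by rewrite -(@ler_rat R) rmorph0 (le_trans s0)// ltW.
have pq : p <= q.
  rewrite -(@ler_rat R); apply: (@le_trans _ _ t); last by rewrite hq.
  exact: ltW.
by have := fq p q p0 pq; rewrite leNgt (lt_trans h1 h2).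
Qed.

(** The path is the difference of two nondecreasing functions, [X i s w + D * s] and [D * s]. The
    lower bound on increments holds almost surely for a fixed pair of times; rational times and
    right continuity extend it to all pairs at once. *)
Lemma linear_exponent_finite_variation n (X : 'I_n -> R -> T -> R) i (J : R ->
  R) C :
  levy_process P X -> laplace_exponent P (X i) J ->
  (forall b, 0 <= b -> J b <= C * b) ->
  {ae P, forall w, forall t, 0 <= t -> bounded_variation 0 t (fun s =>
    X i s w)}.
Proof.
move=> [mX X0 _ statX cadX] lJ JC0.
(* Replacing a possibly negative [C] makes [D * s] nondecreasing. *)
pose D := Num.max C 0; have D0 : 0 <= D by rewrite le_max lexx orbT.
have {JC0} JC b : 0 <= b -> J b <= D * b.
  move=> b0; apply: (le_trans (JC0 b b0)); apply: ler_wpM2r => //.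
  by rewrite le_max lexx.
have step1 h : 0 <= h -> {ae P, forall w, - (D * h) <= X i h w}.
  move=> h0; apply: laplace_ge_ae; first exact: mX.
  move=> b b0; rewrite lJ// lee_fin ler_expR mulrCA [leRHS]mulrA [leRHS]mulrC.
  by apply: ler_wpM2l => //; exact: JC.
have minc s t : 0 <= s -> 0 <= t -> measurable_fun [set: T] (increment X s t).
  move=> s0 t0; apply/measurable_fun_tnthP => j.
  rewrite (_ : _ \o _ = fun w => X j t w - X j s w).
    by apply: measurable_funB; exact: mX.
  by apply/funext => w; rewrite /= tnth_mktuple.
have step2 s h : 0 <= s -> 0 <= h ->
    {ae P, forall w, - (D * h) <= X i (s + h) w - X i s w}.
  move=> s0 h0.
  pose B := [set y : n.-tuple R | tnth y i < - (D * h)].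
  have mB : measurable B.
    rewrite (_ : B = (fun y : n.-tuple R => tnth y i) @^-1` `]-oo, - (D * h)[).
      by rewrite -[X in measurable X]setTI; exact: measurable_tnth.
    by apply/seteqP; split => y; rewrite /B /= in_itv.
  have PB0 : P (increment X 0 h @^-1` B) = 0%E.
    apply/negligibleP; first by rewrite -[X in measurable X]setTI; exact: minc.
    have : {ae P, forall w, - (D * h) <= X i h w - X i 0 w}.
      have := step1 h h0; apply: filterS2 X0 => w w0 /=;
        first by rewrite w0 subr0.
    apply: negligibleS => w /=; rewrite /B /= tnth_mktuple => h1 h2.
    by move: h1; rewrite ltNge h2.
  exists (increment X s (s + h) @^-1` B); split.
  - by rewrite -[X in measurable X]setTI; apply: minc => //; exact: addr_ge0.
  - by rewrite statX.
  - by move=> w /= /negP; rewrite -ltNge /B /= tnth_mktuple.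
have step3 : {ae P, forall w, forall p q : rat, 0 <= p -> p <= q ->
    - (D * ratr (q - p)) <= X i (ratr q) w - X i (ratr p) w}.
  (* Pairs of rationals are enumerated by their codes, so that the exceptional set is a countable
     union; a number coding no pair contributes nothing. *)
  pose F k := if (unpickle k : option (rat * rat)) is Some (p, q) then
    [set w | ~ (0 <= p -> p <= q ->
       - (D * ratr (q - p)) <= X i (ratr q) w - X i (ratr p) w)] else set0.
  have : P.-negligible (\bigcup_k F k).
    apply: negligible_bigcup => k; rewrite /F; case: unpickle => [[p q]|];
      last first.
      exact: negligible_set0.
    have [p0|p0] := boolP (0 <= p); last first.
      by apply: negligibleS (negligible_set0 P) => w /= h; apply: h.
    have [pq|pq] := boolP (p <= q); last first.
      by apply: negligibleS (negligible_set0 P) => w /= h; apply: h.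
    have rp0 : 0 <= ratr p :> R by rewrite ler0q.
    have rq0 : 0 <= ratr (q - p) :> R by rewrite ler0q subr_ge0.
    apply: negligibleS (step2 _ _ rp0 rq0) => w /= h h'; apply: h => _ _.
    have E : ratr p + ratr (q - p) = ratr q :> R.
      by rewrite -rmorphD/= (addrC p) subrK.
    by move: h'; rewrite E.
  apply: negligibleS => w /= /existsNP[p /existsNP[q h]].
  by exists (@pickle (rat * rat)%type (p, q)); [exact: I|rewrite /F pickleK].
move: cadX; apply: filterS2 step3 => w hq cw t t0.
have [rc _] := cw i.
pose W s := X i s w + D * s.
have incW : forall s u, 0 <= s -> s <= u -> W s <= W u.
  apply: nondecreasing_right_continuous_rat.
    move=> s s0; apply: cvgD; first exact: rc.
    apply: cvg_at_right_filter; apply: cvgMr; exact: cvg_id.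
  move=> p q p0 pq; have := hq p q p0 pq; rewrite /W rmorphB/= mulrBr; lra.
move: t0; rewrite le_eqVlt => /predU1P[<-|t0]; first exact: bounded_variationxx.
rewrite (_ : (fun s => X i s w) = W \+ (\- (fun s => D * s))); last first.
  by apply/funext => s; rewrite /W /= addrK.
apply: bounded_variationD => //.
  apply: nondecreasing_bounded_variation => s u;
    rewrite !in_itv/= => /andP[s0 _] _ su.
  exact: incW.
apply: bounded_variationN; apply: nondecreasing_bounded_variation => s u _ _ su.
exact: ler_wpM2l.
Qed.

End finite_variation.


(** * Rigidity of the functional equation *)

Section functional_equation.
Context {R : realType}.
Implicit Types (a b p r t x : R) (J : R -> R).

Lemma powR_unbounded p M : 0 < p -> exists2 x, 0 < x & M < x `^ p.
Proof.
move=> p0; exists ((`|M| + 1) `^ p^-1).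
  by rewrite powR_gt0// ltr_pwDr.
rewrite -powRrM mulVf ?gt_eqF// powRr1 ?addr_ge0//.
by rewrite (le_lt_trans (ler_norm M))// ltrDl.
Qed.

Lemma powRV b a : 0 <= b -> b^-1 `^ a = (b `^ a)^-1.
Proof. by move=> b0; rewrite -powR_inv1// -powRrM mulN1r powRN. Qed.

Lemma powR_inj_base b p r : 0 < b -> b != 1 -> b `^ p = b `^ r -> p = r.
Proof.
move=> b0 b1 /(congr1 (@ln R)); rewrite !ln_powR.
have lnb : ln b != 0 by rewrite ln_eq0.
exact: mulIf.
Qed.

(** The points 1 and 2 suffice: they give a linear system whose determinant is [2^a1 - 2^a2] up to
    sign. *)
Lemma powR_free p q p' q' a1 a2 : a1 != a2 ->
  (forall b, 0 < b -> p * b `^ a1 + q * b `^ a2 =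
    p' * b `^ a1 + q' * b `^ a2) ->
  p = p' /\ q = q'.
Proof.
move=> a12 H; have := H 1 ltr01; have := H 2 (ltr0Sn _ 1).
rewrite !powR1 !mulr1 => H2 H1.
have d : (2 : R) `^ a1 - 2 `^ a2 != 0.
  rewrite subr_eq0; apply: contra_neq a12; apply: powR_inj_base => //.
  by apply/eqP; lra.
suff E : p = p' by split => //; apply: (addrI p); rewrite {2}E.
apply/eqP; rewrite -subr_eq0; apply/eqP; apply: (mulIf d); rewrite mul0r.
move: H1 H2; set u := 2 `^ a1; set v := 2 `^ a2 => H1 H2.
have -> : (p - p') * (u - v) =
    (p * u + q * v) - (p' * u + q' * v) - (p + q - (p' + q')) * v by ring.
by rewrite H1 H2 !subrr mul0r subrr.
Qed.

(** After replacing [r] by its inverse if necessary, [r < 1]; then [J b = J (r^n b)] for all [n],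
    and [r^n b] tends to [0+]. *)
Lemma scale_invariant_eq0 J r b : 0 < r -> r != 1 ->
  (forall x, 0 < x -> J (r * x) = J x) -> J x @[x --> 0^'+] --> 0 ->
  0 < b -> J b = 0.
Proof.
wlog r1 : r / r < 1.
  move=> H r0; rewrite neq_lt => /orP[r1|r1] Jr; first by apply: (H r) => //;
    rewrite lt_eqF.
  apply: (H r^-1); rewrite ?invr_gt0 ?invf_lt1// ?lt_eqF ?invf_lt1//.
  by move=> x x0; rewrite -Jr ?divr_gt0 ?mulrA ?divff ?mul1r ?gt_eqF// mulr_gt0
    ?invr_gt0.
move=> r0 _ Jr J0 b0.
have Jn n : J (r ^+ n * b) = J b.
  elim: n => [|n IH]; first by rewrite expr0 mul1r.
  by rewrite exprS -mulrA Jr ?IH// mulr_gt0// exprn_gt0.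
have pos n : 0 < r ^+ n * b by rewrite mulr_gt0// exprn_gt0.
have H : r ^+ n * b @[n --> \oo] --> (0 : R).
  rewrite -[X in _ --> X](mul0r b); apply: cvgMl; apply: cvg_expr.
  by rewrite gtr0_norm.
apply: contrapT => /eqP Jb0; have e0 : 0 < `|J b| by rewrite normr_gt0.
have /cvgr0Pnorm_lt/(_ _ e0)[e /= e1 He] := J0.
have [n _ /(_ n (leqnn n))/= hn] : \forall n \near \oo, r ^+ n * b < e.
  exact: (cvgr_lt 0 H).
have := He (r ^+ n * b); rewrite /= sub0r normrN gtr0_norm// Jn ltxx.
by move=> /(_ hn (pos n)).
Qed.

(** The right side is a particular solution, since [(r b)^a - b^a = (r^a - 1) b^a] with [r^a]
    different from 1. The difference from [J] is invariant under [r] and tends to 0 at [0+]. *)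
Lemma difference_powR J r k1 k2 a1 a2 : 0 < a1 -> 0 < a2 -> 0 < r -> r != 1 ->
  J x @[x --> 0^'+] --> 0 ->
  (forall b, 0 < b -> J (r * b) - J b = k1 * b `^ a1 + k2 * b `^ a2) ->
  forall b, 0 < b ->
    J b = k1 / (r `^ a1 - 1) * b `^ a1 + k2 / (r `^ a2 - 1) * b `^ a2.
Proof.
move=> a10 a20 r0 r1 J0 H b b0.
have d a : 0 < a -> r `^ a - 1 != 0.
  move=> a0; rewrite subr_eq0; apply/eqP => h.
  have := a0; rewrite (powR_inj_base (p := a) (r := 0) r0 r1) ?ltxx//.
  by rewrite h powRr0.
pose D x := k1 / (r `^ a1 - 1) * x `^ a1 + k2 / (r `^ a2 - 1) * x `^ a2.
apply/eqP; rewrite -subr_eq0; apply/eqP.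
apply: (@scale_invariant_eq0 (fun x => J x - D x) r b) => //.
  move=> x x0; have /eqP := H x x0; rewrite subr_eq => /eqP ->.
  rewrite /D !powRM ?ltW//; set u := r `^ a1 in d *; set v := r `^ a2 in d *.
  have := d _ a10; have := d _ a20; rewrite -/u -/v => d2 d1.
  by field; rewrite d1 d2.
have D0 : D x @[x --> 0^'+] --> k1 / (r `^ a1 - 1) * 0 + k2 / (r `^ a2 - 1) * 0.
  by apply: cvgD; apply: cvgMr; exact: powR_cvg0.
by rewrite !mulr0 addr0 in D0; rewrite -[X in _ --> X](subr0 0); exact: cvgB.
Qed.

(** The exponents may coincide here. The last clause serves the equation with one power, where
    [e2 = 0] and [a1 = a2] and coefficients cannot be separated by linear independence. *)
Lemma ratio_rigidity J1 J2 (G1 G2 : R -> R) e1 e2 a1 a2 :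
  0 < a1 -> 0 < a2 ->
  (forall x, 0 < x -> 0 < G1 x) -> (forall x, 0 < x -> 0 < G2 x) ->
  J2 x @[x --> 0^'+] --> 0 ->
  (forall x b, 0 < x -> 0 < b ->
    J1 (b * G1 x) + J2 (b * G2 x) = x * (e1 * b `^ a1 + e2 * b `^ a2)) ->
  (exists2 k, 0 < k & forall x, 0 < x -> G2 x = k * G1 x) \/
  exists c1 c2 d1 d2, [/\ forall b, 0 < b -> J1 b = c1 * b `^ a1 + d1 * b `^ a2,
    forall b, 0 < b -> J2 b = c2 * b `^ a1 + d2 * b `^ a2 &
    e2 = 0 -> d1 = 0 /\ d2 = 0].
Proof.
move=> a10 a20 G10 G20 J20 H; pose h x := G2 x / G1 x.
have h0 x : 0 < x -> 0 < h x by move=> x0; rewrite divr_gt0 ?G10 ?G20.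
have [hc|/existsNP[y /existsNP[z]]] := pselect (forall x y,
  0 < x -> 0 < y -> h x = h y).
  left; exists (h 1) => [|x x0]; first exact: h0.
  by rewrite (hc 1 x)// divfK// gt_eqF// G10.
move=> /not_implyP[y0 /not_implyP[z0 /eqP hyz]]; right.
pose r1 x := e1 * x / G1 x `^ a1; pose r2 x := e2 * x / G1 x `^ a2.
(* Dividing [b] by [G1 x] frees the argument of [J1] from [x], so that this term cancels between two
   values of [x]. *)
have H1 x b : 0 < x -> 0 < b -> J1 b + J2 (b * h x) =
  r1 x * b `^ a1 + r2 x * b `^ a2.
  move=> x0 b0; have Gx := G10 x x0.
  have := H x (b / G1 x) x0 (divr_gt0 b0 Gx).
  rewrite divfK ?gt_eqF// /h mulrA mulrAC => ->.
  rewrite !powRM ?ltW ?invr_gt0// !(powRV _ (ltW Gx)) /r1 /r2.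
  ring.
pose k1 := (r1 y - r1 z) * (h z)^-1 `^ a1.
pose k2 := (r2 y - r2 z) * (h z)^-1 `^ a2.
have zi : 0 < (h z)^-1 by rewrite invr_gt0 h0.
have D b : 0 < b -> J2 (h y / h z * b) - J2 b = k1 * b `^ a1 + k2 * b `^ a2.
  move=> b0; have bz : 0 < b / h z by rewrite divr_gt0// h0.
  have E1 := H1 y _ y0 bz; have E2 := H1 z _ z0 bz.
  rewrite divfK ?gt_eqF ?h0// in E2.
  have -> : h y / h z * b = b / h z * h y by ring.
  transitivity ((J1 (b / h z) + J2 (b / h z * h y)) - (J1 (b / h z) + J2 b)).
    by ring.
  by rewrite E1 E2 /k1 /k2 !powRM ?ltW//; ring.
have rho0 : 0 < h y / h z by rewrite divr_gt0 ?h0.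
have rho1 : h y / h z != 1.
  by apply: contra_neq hyz => e; rewrite -[LHS](divfK (lt0r_neq0 (h0 z z0))) e
    mul1r.
have J2E := difference_powR a10 a20 rho0 rho1 J20 D.
set c2 := k1 / _ in J2E; set d2 := k2 / _ in J2E.
exists (r1 y - c2 * h y `^ a1), c2, (r2 y - d2 * h y `^ a2), d2; split => //.
  move=> b b0; have E1 := H1 y b y0 b0.
  have := J2E _ (mulr_gt0 b0 (h0 y y0)).
  rewrite !(powRM _ (ltW b0) (ltW (h0 y y0))) => E2.
  transitivity (J1 b + J2 (b * h y) - J2 (b * h y)); first by rewrite addrK.
  by rewrite E1 E2; ring.
move=> e20; have -> : d2 = 0 by rewrite /d2 /k2 /r2 e20 !mul0r subrr !mul0r.
by rewrite /r2 e20 !mul0r subr0.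
Qed.

Lemma single_power_rigidity J1 J2 (G1 G2 : R -> R) e a :
  0 < e -> 0 < a ->
  (forall x, 0 < x -> 0 < G1 x) -> (forall x, 0 < x -> 0 < G2 x) ->
  J2 x @[x --> 0^'+] --> 0 ->
  (forall x b, 0 < x -> 0 < b ->
    J1 (b * G1 x) + J2 (b * G2 x) = x * (e * b `^ a)) ->
  (exists g1 g2, [/\ 0 < g1, 0 < g2,
     forall x, 0 < x -> G1 x = x `^ a^-1 * g1 /\ G2 x = x `^ a^-1 * g2 &
     forall b, 0 < b -> J1 (b * g1) + J2 (b * g2) = e * b `^ a]) \/
  exists c1 c2, [/\ forall b, 0 < b -> J1 b = c1 * b `^ a,
    forall b, 0 < b -> J2 b = c2 * b `^ a &
    forall x, 0 < x -> c1 * G1 x `^ a + c2 * G2 x `^ a = e * x].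
Proof.
move=> e0 a0 G10 G20 J20 H.
have H' x b : 0 < x -> 0 < b ->
    J1 (b * G1 x) + J2 (b * G2 x) = x * (e * b `^ a + 0 * b `^ a).
  by move=> x0 b0; rewrite H// mul0r addr0.
have [[k k0 Gk]|[c1 [c2 [d1 [d2 [E1 E2 /(_ erefl)[d10 d20]]]]]]] :=
    ratio_rigidity a0 a0 G10 G20 J20 H'; [left|right].
  (* With [b = 1 / G1 x] the left side of the equation is [J1 1 + J2 k], the same for all [x]. *)
  have Gpow x y : 0 < x -> 0 < y -> x / G1 x `^ a = y / G1 y `^ a.
    move=> x0 y0.
    have := H x (G1 x)^-1 x0; have := H y (G1 y)^-1 y0.
    rewrite !Gk// !(mulrC _^-1) -!mulrA !divff ?gt_eqF ?G10// !mulr1.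
    rewrite !invr_gt0 !G10// => /(_ isT) -> /(_ isT).
    rewrite (powRV _ (ltW (G10 x x0))) (powRV _ (ltW (G10 y y0))) => h.
    apply: (mulIf (lt0r_neq0 e0)); rewrite [LHS]mulrAC [RHS]mulrAC.
    by rewrite -!mulrA -h.
  have G1E x : 0 < x -> G1 x = x `^ a^-1 * G1 1.
    move=> x0; have := Gpow x 1 x0 ltr01.
    have nz y : 0 < y -> G1 y `^ a != 0 by move=> y0;
      rewrite gt_eqF// powR_gt0// G10.
    move=> /eqP; rewrite eqr_div ?nz// mul1r => /eqP h.
    have := congr1 (fun y => y `^ a^-1) h.
    rewrite powRM ?powR_ge0 ?ltW// -!powRrM mulfV ?gt_eqF// !powRr1 ?ltW ?G10//.
  exists (G1 1), (G2 1); split; rewrite ?G10 ?G20//.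
    move=> x x0; rewrite !Gk// G1E//; split => //; ring.
  by move=> b b0; rewrite H// mul1r.
exists c1, c2; split.
- by move=> b b0; rewrite E1// d10 mul0r addr0.
- by move=> b b0; rewrite E2// d20 mul0r addr0.
- move=> x x0; have := H x 1 x0 ltr01; rewrite !mul1r E1 ?E2 ?G10 ?G20//.
  by rewrite d10 d20 !mul0r !addr0 powR1 mulr1 (mulrC x).
Qed.

(** Near 0 the smaller exponent dominates: if [d1] were nonzero, [J (2 x) / J x] would tend to
    [2^a2] and not to [2^a1]. *)
Lemma regularly_varying0_power J c1 d1 a1 a2 : a2 < a1 ->
  (forall b, 0 < b -> J b = c1 * b `^ a1 + d1 * b `^ a2) ->
  regularly_varying0 J a1 -> d1 = 0.
Proof.
move=> a21 JE rv; apply: contrapT => /eqP d10.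
have := rv 2 (ltr0Sn _ 1) => rv2.
have da : 0 < a1 - a2 by rewrite subr_gt0.
have lim2 : J (2 * x) / J x @[x --> 0^'+] --> (2 : R) `^ a2.
  have -> : 2 `^ a2 = (c1 * 2 `^ a1 * 0 + d1 * 2 `^ a2) / (c1 * 0 + d1) :> R.
    by rewrite !mulr0 !add0r mulrAC mulfV// mul1r.
  have q0 : x `^ (a1 - a2) @[x --> (0:R)^'+] --> (0 : R) by exact: powR_cvg0.
  have : (c1 * 2 `^ a1 * x `^ (a1 - a2) + d1 * 2 `^ a2) / (c1 * x `^ (a1 - a2)
    + d1)
      @[x --> (0:R)^'+] --> (c1 * 2 `^ a1 * 0 + d1 * 2 `^ a2) / (c1 * 0 + d1).
    apply: cvgM.
      by apply: cvgD; [apply: cvgMr|exact: cvg_cst].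
    apply: cvgV; first by rewrite mulr0 add0r.
    by apply: cvgD; [apply: cvgMr|exact: cvg_cst].
  apply: cvg_trans; apply: near_eq_cvg; near=> x.
  have x0 : 0 < x by [].
  rewrite !JE ?mulr_gt0// !powRM ?ltW//.
  have -> : x `^ a1 = x `^ (a1 - a2) * x `^ a2.
    rewrite -powRD ?subrK//; apply/implyP => _; exact: lt0r_neq0.
  have xa : x `^ a2 != 0 by rewrite gt_eqF// powR_gt0.
  set q := x `^ (a1 - a2); set m := x `^ a2 in xa *.
  rewrite [X in _ = X / _](_ : _ = (c1 * 2 `^ a1 * q + d1 * 2 `^ a2) * m);
    last by ring.
  rewrite [X in _ = _ / X](_ : _ = (c1 * q + d1) * m); last by ring.
  by rewrite -mulf_div divff ?mulr1.
have E : (2 : R) `^ a1 = 2 `^ a2 by exact: (cvg_unique _ rv2 lim2).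
move: a21; rewrite (powR_inj_base _ _ E) ?ltxx//.
by apply/eqP; lra.
Unshelve. all: by end_near. Qed.

Lemma two_power_rigidity J1 J2 (G1 G2 : R -> R) e1 e2 a1 a2 :
  0 < e1 -> 0 < e2 -> 0 < a2 -> a2 < a1 ->
  (forall x, 0 < x -> 0 < G1 x) -> (forall x, 0 < x -> 0 < G2 x) ->
  (forall b, 0 < b -> 0 <= J1 b) -> (forall b, 0 < b -> 0 <= J2 b) ->
  J2 x @[x --> 0^'+] --> 0 -> regularly_varying0 J1 a1 ->
  (forall x b, 0 < x -> 0 < b ->
    J1 (b * G1 x) + J2 (b * G2 x) = x * (e1 * b `^ a1 + e2 * b `^ a2)) ->
  exists c1 d2, [/\ 0 < c1 /\ 0 < d2,
    forall b, 0 < b -> J1 b = c1 * b `^ a1,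
    forall b, 0 < b -> J2 b = d2 * b `^ a2 &
    forall x, 0 < x -> c1 * G1 x `^ a1 = e1 * x /\ d2 * G2 x `^ a2 = e2 * x].
Proof.
move=> e10 e20 a20 a21 G10 G20 J1ge J2ge J20 rv H.
have a10 : 0 < a1 by apply: lt_trans a21.
have a12 : a1 != a2 by rewrite gt_eqF.
have [[k k0 Gk]|[c1 [c2 [d1 [d2 [E1 E2 _]]]]]] :=
    ratio_rigidity a10 a20 G10 G20 J20 H.
  (* Constant ratio: the left side is independent of [x], so the coefficients at [x = 1] and [x = 2]
     agree. With [t = G1 2 / G1 1] this gives [t^a1 = 2 = t^a2], impossible for distinct
     exponents. *)
  have F x b : 0 < x -> 0 < b -> J1 b + J2 (b * k) =
      (e1 * x / G1 x `^ a1) * b `^ a1 + (e2 * x / G1 x `^ a2) * b `^ a2.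
    move=> x0 b0; have Gx := G10 x x0.
    have := H x (b / G1 x) x0 (divr_gt0 b0 Gx);
      rewrite Gk// mulrCA divfK ?gt_eqF// (mulrC k) => ->.
    rewrite !powRM ?ltW ?invr_gt0// !(powRV _ (ltW Gx)).
    ring.
  have [] := @powR_free (e1 * 2 / G1 2 `^ a1) (e2 * 2 / G1 2 `^ a2)
      (e1 * 1 / G1 1 `^ a1) (e2 * 1 / G1 1 `^ a2) _ _ a12.
    by move=> b b0; rewrite -!F.
  have G1p := G10 1 ltr01; have G2p := G10 2 (ltr0Sn _ 1).
  have red e a : 0 < e -> e * 2 / G1 2 `^ a =
    e * 1 / G1 1 `^ a -> (G1 2 / G1 1) `^ a = 2.
    have nz y : 0 < y -> y `^ a != 0 by move=> y0; rewrite gt_eqF// powR_gt0.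
    move=> e0' /eqP; rewrite eqr_div ?nz// mulr1 => /eqP h'.
    have h : 2 * G1 1 `^ a = G1 2 `^ a.
      by apply: (mulfI (lt0r_neq0 e0')); rewrite mulrA h'.
    rewrite powRM ?invr_ge0 ?ltW// powRV ?ltW//.
    by rewrite -h mulfK// gt_eqF// powR_gt0.
  move=> /(red _ _ e10) h1 /(red _ _ e20) h2.
  have t0 : 0 < G1 2 / G1 1 by rewrite divr_gt0.
  case: (eqVneq (G1 2 / G1 1) 1) => [t1|t1].
    by move: h1; rewrite t1 powR1 => /eqP;
      rewrite eq_sym -subr_eq0 -addrA subrr addr0 oner_eq0.
  by move: a21; rewrite (powR_inj_base t0 t1 (etrans h1 (esym h2))) ltxx.
have d10 := regularly_varying0_power a21 E1 rv.
have Q x : 0 < x -> c1 * G1 x `^ a1 + c2 * G2 x `^ a1 =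
  e1 * x /\ d2 * G2 x `^ a2 = e2 * x.
  move=> x0; apply: (powR_free a12) => b b0.
  have := H x b x0 b0; rewrite E1 ?E2 ?mulr_gt0 ?G10 ?G20// d10 !powRM ?ltW
    ?G10 ?G20// => h.
  rewrite mul0r addr0 in h.
  transitivity (x * (e1 * b `^ a1 + e2 * b `^ a2)); last by ring.
  by rewrite -h; ring.
have d20 : 0 < d2.
  have [_ h] := Q 1 ltr01.
  by rewrite -(@pmulr_lgt0 _ (G2 1 `^ a2)) ?powR_gt0 ?G20// h mulr1.
have da : 0 < a1 - a2 by rewrite subr_gt0.
have split_pow b : 0 < b -> b `^ a1 = b `^ (a1 - a2) * b `^ a2.
  move=> b0; rewrite -powRD ?subrK//; apply/implyP => _; exact: lt0r_neq0.
(* Otherwise [J2 b = b^a2 (c2 b^(a1 - a2) + d2)] would be negative for large [b]. *)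
have c2ge : 0 <= c2.
  rewrite leNgt; apply/negP => c2n.
  have [b b0 hb] := powR_unbounded (d2 / - c2) da.
  have := J2ge b b0; rewrite E2// split_pow// mulrA -mulrDl leNgt => /negP;
    apply.
  rewrite pmulr_llt0 ?powR_gt0//; move: hb; rewrite ltr_pdivrMr ?oppr_gt0//.
  lra.
have c1ge : 0 <= c1.
  by have := J1ge 1 ltr01; rewrite E1// d10 powR1 mul0r addr0 mulr1.
(* From [d2 G2^a2 = e2 x], the term [c2 G2^a1] equals [K x^be] with [be = a1 / a2 > 1]. If [c2 > 0]
   it outgrows [e1 x], although the other summand [c1 G1^a1] is nonnegative. *)
have c20 : c2 = 0.
  apply: contrapT => /eqP c2n; have c2p : 0 < c2 by rewrite lt_def c2n.
  pose be := a1 / a2; have be1 : 0 < be - 1 by rewrite subr_gt0 ltr_pdivlMr//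
    mul1r.
  pose K := c2 * (e2 / d2) `^ be.
  have K0 : 0 < K by rewrite mulr_gt0// powR_gt0// divr_gt0.
  have [x x0 hx] := powR_unbounded (e1 / K) be1.
  have [h1 h2] := Q x x0.
  have G2E : G2 x `^ a1 = (e2 / d2) `^ be * x `^ be.
    rewrite -powRM ?divr_ge0 ?ltW// mulrAC -h2 (mulrC d2) mulfK ?gt_eqF//.
    by rewrite -powRrM /be mulrC divfK// gt_eqF.
  have : K * x `^ be <= e1 * x.
    by rewrite -h1 G2E mulrA lerDr mulr_ge0// powR_ge0.
  rewrite leNgt => /negP; apply.
  have -> : x `^ be = x `^ (be - 1) * x.
    rewrite -[X in _ * X]powRr1 ?ltW// -powRD ?subrK//.
    by apply/implyP => _; exact: lt0r_neq0.
  by rewrite mulrA ltr_pM2r// mulrC -ltr_pdivrMr.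
exists c1, d2; split.
- split => //; have [h _] := Q 1 ltr01.
  move: h; rewrite c20 mul0r addr0 mulr1 => h.
  by rewrite -(@pmulr_lgt0 _ (G1 1 `^ a1)) ?powR_gt0 ?G10// h.
- by move=> b b0; rewrite E1// d10 mul0r addr0.
- by move=> b b0; rewrite E2// c20 mul0r add0r.
- by move=> x x0; have [h1 h2] := Q x x0; rewrite c20 mul0r addr0 in h1.
Qed.

End functional_equation.


Lemma ord2P (i : 'I_2) : i = ord0 \/ i = ord_max.
Proof. by case: i => [[|[|//]] p]; [left|right]; exact: val_inj. Qed.

(** * Exponents of scaled and of projected measures *)

Section Jmu_facts.
Context {R : realType}.
Variables (c : R) (mu : {measure set R -> \bar R}).
Hypothesis bp : branching_parameters c mu.
Let D : set R := `]0, +oo[.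
Let mD : measurable D. Proof. exact: measurable_itv. Qed.

Lemma Jmu_ge0 b : 0 <= Jmu c mu b.
Proof.
rewrite JmuE addr_ge0//.
  by apply: mulr_ge0; [case: bp|exact: sqr_ge0].
by apply: Rintegral_ge0 => v _; exact: psi_ge0.
Qed.

Lemma Jmu_cvg0 : Jmu c mu b @[b --> 0^'+] --> 0.
Proof.
have iM := branching_integrable bp.
pose K := \int[mu]_(v in D) Num.min v (v ^+ 2).
apply: (squeeze_cvgr (f := fun=> 0) (h := fun b =>
  c * b ^+ 2 + (b + b ^+ 2) * K)).
- near=> b; have b0 : 0 <= b by apply: ltW; near: b; exact: nbhs_right_gt.
  rewrite Jmu_ge0/= JmuE lerD2l -RintegralZl//.
  apply: le_Rintegral => //.
  + exact: psi_integrable bp.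
  + exact: (integrableZl mD (b + b ^+ 2) iM).
  + move=> v; rewrite /D/= in_itv/= andbT => /ltW v0.
    by apply: psi_le_min => //; exact: mulr_ge0.
- exact: cvg_cst.
(* The rewriting also reaches the base point of the filter, hence the form of [c1] and [c2]. *)
- have -> : 0 = c * 0 ^+ 2 + (0 + 0 ^+ 2) * K :> R by ring.
  have c1 : (fun b : R => b) @ (c * 0 ^+ 2 + (0 + 0 ^+ 2) * K)^'+ --> (0 : R).
    rewrite expr0n/= mulr0 addr0 mul0r addr0.
    by apply: cvg_at_right_filter; exact: cvg_id.
  have c2 : (fun b : R => b ^+ 2) @ (c * 0 ^+ 2 + (0 + 0 ^+ 2) * K)^'+ --> (0
    ^+ 2 : R).
    exact: cvgM.
  by apply: cvgD; [exact: cvgMr|apply: cvgMl; exact: cvgD].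
Unshelve. all: by end_near. Qed.

Lemma scaled_branching (x : {nonneg R}) :
  branching_parameters (c * x%:num) (mscale x mu).
Proof.
have [c0 moo] := bp; split; first exact: mulr_ge0.
rewrite ge0_integral_mscale//.
- by rewrite lte_mul_pinfty.
- by apply/measurable_EFinP; apply: measurable_minr.
- by move=> v; rewrite /= in_itv/= andbT => v0;
  rewrite lee_fin le_min ltW//= sqr_ge0.
Qed.

Lemma Jmu_scale (x : {nonneg R}) b : 0 <= b ->
  Jmu (c * x%:num) (mscale x mu) b = x%:num * Jmu c mu b.
Proof.
move=> b0; have ip := psi_integrable b0 bp.
have E : (\int[mscale x mu]_(v in D) (psi (b * v))%:E =
    x%:num%:E * \int[mu]_(v in D) (psi (b * v))%:E)%E.
  apply: ge0_integral_mscale => //; first exact: measurable_int ip.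
  by move=> v _; rewrite lee_fin psi_ge0.
rewrite !JmuE /Rintegral E fineM//=; last exact: integrable_fin_num.
by ring.
Qed.

End Jmu_facts.

Section projection.
Context {d : measure_display} {T : measurableType d} {R : realType}.
Variables (nu : {measure set (2.-tuple R) -> \bar R}).
Hypotheses (nu_neg : nu [set y | exists i, tnth y i < 0] = 0%E).
Hypothesis nu_fin : (\int[nu]_y (Num.min (norm2 y) (norm2 y ^+ 2))%:E < +oo)%E.
Let D : set R := `]0, +oo[.
Let mD : measurable D. Proof. exact: measurable_itv. Qed.

(** [projected_measure] with its measure structure; transparent, so that the two are convertible. *)
Definition dot_image (u : 'I_2 -> R) : {measure set R -> \bar R}.
Proof. by refine (pushforward nu (dot u)); exact: measurable_dot. Defined.

Lemma dot2 (u : 'I_2 -> R) y : dot u y =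
  u ord0 * tnth y ord0 + u ord_max * tnth y ord_max.
Proof.
rewrite /dot big_ord_recl big_ord1; congr (_ + u _ * tnth y _); exact: val_inj.
Qed.

Lemma orthant_ae : {ae nu, forall y, forall i, 0 <= tnth y i}.
Proof.
have mt i : measurable_fun [set: 2.-tuple R] (fun y =>
  tnth y i) by exact: measurable_tnth.
have E : [set y : 2.-tuple R | exists i, tnth y i < 0] =
    (fun y => tnth y ord0) @^-1` `]-oo,
      0[ `|` (fun y => tnth y ord_max) @^-1` `]-oo, 0[.
  apply/seteqP; split => y /=; rewrite !in_itv/=.
    by move=> [i]; case: (ord2P i) => ->; [left|right].
  by case; [exists ord0|exists ord_max].
exists [set y | exists i, tnth y i < 0]; split => //.
  by rewrite E; apply: measurableU; rewrite -[X in measurable X]setTI;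
    apply: mt.
by move=> y /= /existsNP[i /negP]; rewrite -ltNge => yi; exists i.
Qed.

Variable u : 'I_2 -> R.
Hypothesis u0 : forall i, 0 <= u i.

Lemma dot_ae : {ae nu, forall y, 0 <= dot u y <= (u ord0 + u ord_max) * norm2
  y}.
Proof.
apply: filterS orthant_ae => y y0; rewrite dot2; apply/andP; split.
  by rewrite addr_ge0// mulr_ge0.
by rewrite mulrDl; apply: lerD; apply: ler_wpM2l => //;
  apply: le_trans (tnth_le_norm2 y _); exact: ler_norm.
Qed.

(** Restricting to positive values loses nothing: [dot u y] is nonnegative for almost every [y], and
    [h] vanishes at 0. *)
Lemma integral_proj (h : R -> R) : measurable_fun [set: R] h ->
  (forall v, 0 <= h v) -> h 0 = 0 ->
  (\int[dot_image u]_(v in D) (h v)%:E = \int[nu]_y (h (dot u y))%:E)%E.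
Proof.
move=> mh h0 h00; have md := measurable_dot u.
have mhE : measurable_fun D (fun v => (h v)%:E).
  by apply/measurable_EFinP; exact: measurable_funTS.
have hE : ({in D, forall v, 0 <= (h v)%:E})%E by move=> v _; rewrite lee_fin.
rewrite -[LHS]/(\int[pushforward nu (dot u)]_(v in D) (h v)%:E)%E.
apply: (etrans (ge0_integral_pushforward md nu mD mhE hE)).
have mf : measurable_fun [set: 2.-tuple R] (fun y => (h (dot u y))%:E).
  by apply/measurable_EFinP; exact: measurableT_comp.
have mE : measurable (dot u @^-1` D) by rewrite -[X in measurable X]setTI;
  exact: md.
rewrite integral_mkcond; apply: ge0_ae_eq_integral => //.
- by apply/(measurable_restrictT _ mE); exact: measurable_funTS.
- by move=> y _; rewrite patchE; case: ifP => // _; rewrite lee_fin.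
- by move=> y _; rewrite lee_fin.
apply: filterS dot_ae => y /andP[y0 _] _; rewrite patchE; case: ifPn => //.
rewrite notin_setE /D /= in_itv/= andbT => /negP; rewrite -leNgt => yle.
by have -> : dot u y = 0 by [apply/eqP; rewrite eq_le yle y0]; rewrite h00.
Qed.

Lemma proj_branching c : 0 <= c -> branching_parameters c (dot_image u).
Proof.
move=> c0; split => //.
(* The minimum is negative for [v < 0]; truncation gives a function nonnegative everywhere with the
   same values on the half line. *)
pose h v : R := Num.max 0 (Num.min v (v ^+ 2)).
have mh : measurable_fun [set: R] h.
  by apply: measurable_maxr => //; apply: measurable_minr => //.
have h0 v : 0 <= h v by rewrite le_max lexx.
have hE v : 0 <= v -> h v = Num.min v (v ^+ 2).
  by move=> v0; rewrite /h max_r// le_min v0 sqr_ge0.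
rewrite (_ : (\int[_]_(v in _) _)%E = (\int[dot_image u]_(v in D) (h v)%:E)%E);
  last first.
  by apply: eq_integral => v; rewrite inE/= in_itv/= andbT => v0;
    rewrite hE// ltW.
rewrite integral_proj//; last by rewrite hE// expr0n/= minxx.
pose M := u ord0 + u ord_max.
have M0 : 0 <= M by rewrite addr_ge0.
have mn : measurable_fun [set: 2.-tuple R] (fun y =>
  (Num.min (norm2 y) (norm2 y ^+ 2))%:E).
  apply/measurable_EFinP; apply: measurable_minr; first exact: measurable_norm2.
  by apply: measurable_funX; exact: measurable_norm2.
apply: (@le_lt_trans _ _ (\int[nu]_y ((M + M ^+ 2)%:E * (Num.min (norm2 y)
  (norm2 y ^+ 2))%:E))%E).
  apply: ae_ge0_le_integral => //.
  - by move=> y _; rewrite lee_fin.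
  - by apply/measurable_EFinP; apply: measurableT_comp => //;
    exact: measurable_dot.
  - by move=> y _; rewrite -EFinM lee_fin mulr_ge0 ?addr_ge0 ?sqr_ge0// le_min
    norm2_ge0 sqr_ge0.
  - exact: measurable_funeM.
  apply: filterS dot_ae => y /andP[y0 yM] _.
  by rewrite -EFinM lee_fin hE//; apply: min_sqr_le => //; exact: norm2_ge0.
rewrite ge0_integralZl//; last 2 first.
- by move=> y _; rewrite lee_fin le_min norm2_ge0 sqr_ge0.
- by rewrite lee_fin addr_ge0// sqr_ge0.
by rewrite lte_mul_pinfty// lee_fin addr_ge0// sqr_ge0.
Qed.

Lemma dotZ b y : dot (fun i => b * u i) y = b * dot u y.
Proof. by rewrite /dot mulr_sumr; apply: eq_bigr => i _; rewrite mulrA. Qed.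

Lemma qformZ (Q : 'M[R]_2) b : qform Q (fun i => b * u i) = b ^+ 2 * qform Q u.
Proof.
rewrite /qform mulr_sumr; apply: eq_bigr => i _.
by rewrite mulr_sumr; apply: eq_bigr => j _; ring.
Qed.

Lemma Jmu_projE (Q : 'M[R]_2) b : 0 <= b ->
  Jmu (2^-1 * qform Q u) (dot_image u) b =
  2^-1 * qform Q (fun i => b * u i) +
  \int[nu]_y (expR (- dot (fun i => b * u i) y) - 1 + dot (fun i => b * u i) y).
Proof.
move=> b0; rewrite JmuE qformZ; congr (_ + _); first by ring.
rewrite /Rintegral; congr fine; rewrite (integral_proj (h := fun v =>
  psi (b * v))).
- by apply: eq_integral => y _; rewrite dotZ.
- by apply: measurableT_comp; [exact: measurable_psi|exact: measurable_funM].
- by move=> v; exact: psi_ge0.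
- by rewrite mulr0 psi0.
Qed.

End projection.

(** * Stability read off from the Laplace exponent *)

Section stable_from_laplace.
Context {d : measure_display} {T : measurableType d} {R : realType}.
Variable P : probability T R.

Lemma stable_of_exponent (Y : R -> T -> R) a c : 1 < a -> a <= 2 -> 0 < c ->
  levy_martingale P (fun _ : 'I_1 => Y) ->
  laplace_exponent P Y (fun b => c * b `^ a) -> stable_process P a Y.
Proof.
move=> a1; rewrite le_eqVlt => /predU1P[->|a2] c0 LY lY; split => //;
  last first.
  by left; split; [rewrite a1 a2|exact: (stable_characteristics a1 a2 c0 lY)].
(* A Wiener process of variance [sigma2] has exponent [sigma2 / 2 * b^2]. *)
right; split => //; exists (2 * c); split; first by rewrite mulr_gt0.
have qE u : qform ((2 * c)%:M : 'M[R]_1) u = 2 * c * u ord0 ^+ 2.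
  by rewrite /qform !big_ord1 mxE eqxx mulr1n; ring.
split => //.
- split; first exact: tr_scalar_mx.
  by move=> u; rewrite qE mulr_ge0 ?sqr_ge0 ?mulr_ge0// ltW.
- by rewrite integral_measure_zero.
- move=> t b t0 b0.
  have -> : (fun w : T => expR (- \sum_(i < 1) b i * Y t w)) =
      (fun w => expR (- b ord0 * Y t w)).
    by apply/funext => w; rewrite big_ord1 mulNr.
  rewrite lY// qE /Rintegral integral_measure_zero addr0.
  rewrite -[X in _ `^ X]/(2%:R) powR_mulrn//.
  by congr (expR (t * _))%:E; field.
Qed.

End stable_from_laplace.

(** * Generating pairs and the functional equation *)

Section generating.
Context {d : measure_display} {T : measurableType d} {R : realType}.
Variable P : probability T R.
Variables (Z1 Z2 : R -> T -> R).
Hypothesis Z_levy : levy_martingale P (vec2 Z1 Z2).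
Variables (Q : 'M[R]_2) (nu : {measure set (2.-tuple R) -> \bar R}).
Hypothesis Z_char : levy_characteristics P (vec2 Z1 Z2) Q nu.
Hypothesis Z_indep : independent_processes P Z1 Z2.
Hypothesis Z1_infvar : infinite_variation P Z1.
Hypothesis Z2_infvar : infinite_variation P Z2.
Variables J1 J2 : R -> R.
Hypothesis Z1_exponent : laplace_exponent P Z1 J1.
Hypothesis Z2_exponent : laplace_exponent P Z2 J2.
Let D : set R := `]0, +oo[.
Let mD : measurable D. Proof. exact: measurable_itv. Qed.

Let nu_neg : nu [set y | exists i, tnth y i < 0] = 0%E.
Proof. by case: Z_char. Qed.

Let nu_fin : (\int[nu]_y (Num.min (norm2 y) (norm2 y ^+ 2))%:E < +oo)%E.
Proof. by case: Z_char. Qed.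

Let mZ1 t : 0 <= t -> measurable_fun [set: T] (Z1 t).
Proof. by move=> t0; case: Z_levy => [[mX _ _ _ _] _]; exact: (mX ord0). Qed.

Let mZ2 t : 0 <= t -> measurable_fun [set: T] (Z2 t).
Proof. by move=> t0; case: Z_levy => [[mX _ _ _ _] _]; exact: (mX ord_max). Qed.

Let vec2_ge0 (u1 u2 : R) : 0 <= u1 -> 0 <= u2 -> forall i, 0 <= vec2 u1 u2 i.
Proof. by move=> *; rewrite /vec2; case: ifP. Qed.

Let qform_ge0 u : 0 <= 2^-1 * qform Q u.
Proof. by case: Z_char => -[_ q0] _ _ _ _; rewrite mulr_ge0// invr_ge0. Qed.

Lemma exponents_proj u1 u2 b : 0 <= u1 -> 0 <= u2 -> 0 <= b ->
  J1 (b * u1) + J2 (b * u2) =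
  Jmu (2^-1 * qform Q (vec2 u1 u2)) (dot_image nu (vec2 u1 u2)) b.
Proof.
move=> u10 u20 b0; have v0 := vec2_ge0 u10 u20.
have [_ _ _ _ lK] := Z_char.
have h := laplace_indep Z_indep Z1_exponent Z2_exponent ler01 (mZ1 ler01) (mZ2
  ler01)
  (mulr_ge0 b0 u10) (mulr_ge0 b0 u20).
have bv0 i : 0 <= b * vec2 u1 u2 i by rewrite mulr_ge0.
have := lK 1 (fun i => b * vec2 u1 u2 i) ler01 bv0.
rewrite -Jmu_projE//; set j := Jmu _ _ _.
rewrite (_ : (fun w => _) = (fun w => expR (- (b * u1 * Z1 1 w + b * u2 * Z2 1
  w)))); last first.
  by apply/funext => w; rewrite big_ord_recl big_ord1.
by rewrite h !mul1r => -[/expR_inj].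
Qed.

Lemma proj_vec_branching u1 u2 : 0 <= u1 -> 0 <= u2 ->
  branching_parameters (2^-1 * qform Q (vec2 u1 u2)) (dot_image nu (vec2 u1
    u2)).
Proof. by move=> *; apply: proj_branching => //; exact: vec2_ge0. Qed.

Lemma exponent0 (Y : R -> T -> R) (J : R -> R) : laplace_exponent P Y J -> J 0
  = 0.
Proof.
move=> /(_ 1 0 ler01 (lexx _)).
rewrite (_ : (fun w => _) = cst 1); last first.
  by apply/funext => w; rewrite oppr0 mul0r expR0.
rewrite expectation_cst mul1r => -[].
by rewrite -expR0 => /expR_inj.
Qed.

Let J1_0 : J1 0 = 0. Proof. exact: exponent0 Z1_exponent. Qed.
Let J2_0 : J2 0 = 0. Proof. exact: exponent0 Z2_exponent. Qed.

Let J1E b : 0 <= b -> J1 b = Jmu (2^-1 * qform Q (vec2 1 0)) (dot_image nu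
  (vec2 1 0)) b.
Proof. by move=> b0; rewrite -exponents_proj// mulr1 mulr0 J2_0 addr0. Qed.

Let J2E b : 0 <= b -> J2 b = Jmu (2^-1 * qform Q (vec2 0 1)) (dot_image nu
  (vec2 0 1)) b.
Proof. by move=> b0; rewrite -exponents_proj// mulr1 mulr0 J1_0 add0r. Qed.

Lemma exponent1_ge0 b : 0 <= b -> 0 <= J1 b.
Proof. by move=> b0; rewrite J1E//; apply: Jmu_ge0;
  exact: proj_vec_branching. Qed.

Lemma exponent2_ge0 b : 0 <= b -> 0 <= J2 b.
Proof. by move=> b0; rewrite J2E//; apply: Jmu_ge0;
  exact: proj_vec_branching. Qed.

Lemma exponent2_cvg0 : J2 b @[b --> 0^'+] --> 0.
Proof.
have bp := proj_vec_branching (lexx 0) ler01.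
apply: cvg_trans (Jmu_cvg0 bp); apply: near_eq_cvg; near=> b.
by rewrite J2E// ltW.
Unshelve. all: by end_near. Qed.

Lemma exponent1_not_linear C : ~ (forall b, 0 <= b -> J1 b <= C * b).
Proof.
move=> JC; apply: Z1_infvar; case: Z_levy => LX _.
exact: (linear_exponent_finite_variation (i := ord0) LX Z1_exponent JC).
Qed.

Lemma exponent2_not_linear C : ~ (forall b, 0 <= b -> J2 b <= C * b).
Proof.
move=> JC; apply: Z2_infvar; case: Z_levy => LX _.
exact: (linear_exponent_finite_variation (i := ord_max) LX Z2_exponent JC).
Qed.

Section pair.
Variables (G1 G2 : R -> R) (c : R) (mu : {measure set R -> \bar R}).
Hypotheses (G1_ge0 : forall x, 0 <= x -> 0 <= G1 x) (G2_ge0 : forall x,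
  0 <= x -> 0 <= G2 x).
Hypothesis c_mu : branching_parameters c mu.
Let G x := vec2 (G1 x) (G2 x).

Lemma generating_pair_at0 : generating_pair G Q nu c mu -> G1 0 = 0 /\ G2 0 = 0.
Proof.
move=> [_ fin q _].
have g1 := G1_ge0 (lexx 0); have g2 := G2_ge0 (lexx 0).
have q0 : 2^-1 * qform Q (G 0) = 0 by rewrite q ?mulr0.
have iv : (dot_image nu (G 0)).-integrable D (EFin \o id).
  apply/integrableP; split; first exact/measurable_EFinP.
  apply: le_lt_trans fin; rewrite le_eqVlt; apply/orP; left; apply/eqP.
  by apply: eq_integral => v; rewrite inE /D/= in_itv/= andbT => v0;
    rewrite gtr0_norm.
have bp := proj_vec_branching g1 g2.
pose C := \int[dot_image nu (G 0)]_(v in D) v.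
(* At [x = 0] the variance is [c * 0], and [psi v <= v] bounds the rest by the finite first moment.
   Each exponent inherits the bound because the other one is nonnegative. *)
have bound b : 0 <= b -> J1 (b * G1 0) + J2 (b * G2 0) <= C * b.
  move=> b0; rewrite exponents_proj// JmuE -/(G 0) q0 mul0r add0r mulrC /C.
  rewrite -RintegralZl//; apply: le_Rintegral => //.
  - exact: psi_integrable bp.
  - exact: (integrableZl mD b iv).
  - move=> v; rewrite /D/= in_itv/= andbT => /ltW v0.
    by apply: psi_lex; exact: mulr_ge0.
split; apply/eqP; rewrite eq_le ?g1 ?g2 andbT leNgt; apply/negP => gp.
  apply: (@exponent1_not_linear (C / G1 0)) => b b0.
  have h : 0 <= b / G1 0 by rewrite divr_ge0.
  have B := bound _ h; rewrite divfK ?gt_eqF// in B.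
  rewrite mulrAC -mulrA; apply: le_trans B.
  by rewrite lerDl exponent2_ge0// mulr_ge0.
apply: (@exponent2_not_linear (C / G2 0)) => b b0.
have h : 0 <= b / G2 0 by rewrite divr_ge0.
have B := bound _ h; rewrite divfK ?gt_eqF// in B.
rewrite mulrAC -mulrA; apply: le_trans B.
by rewrite lerDr exponent1_ge0// mulr_ge0.
Qed.

Lemma generating_pairP : generating_pair G Q nu c mu <->
  [/\ G1 0 = 0, G2 0 = 0 & forall x b, 0 < x -> 0 <= b ->
     J1 (b * G1 x) + J2 (b * G2 x) = x * Jmu c mu b].
Proof.
split=> [gp|[G10 G20 eqJ]].
  have [G10 G20] := generating_pair_at0 gp; split => // x b x0 b0.
  have [_ _ q H] := gp.
  rewrite exponents_proj ?G1_ge0 ?G2_ge0 ?(ltW x0)//.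
  rewrite -(Jmu_scale c_mu (NngNum (ltW x0)))// !JmuE -/(G x) q ?ltW// (mulrC
    c)/=.
  congr (_ + _); rewrite /Rintegral; congr fine.
  apply: eq_measure_integral => A mA AD.
  rewrite -[LHS]/(projected_measure nu (G x) A) H ?ltW//.
  rewrite /projected_measure /pushforward.
  rewrite (_ : dot (G 0) @^-1` A = set0) ?measure0 ?add0e//.
  apply/seteqP; split => // y /= /AD;
    rewrite /= in_itv/= andbT dot2 /G /vec2/= G10 G20.
  by rewrite !mul0r addr0 ltxx.
(* As [G 0 = 0], the projection at 0 is identically zero and puts no mass on the positive half
   line. *)
have pull0 A : A `<=` D -> projected_measure nu (G 0) A = 0%E.
  move=> AD; rewrite /projected_measure /pushforward.
  rewrite (_ : dot (G 0) @^-1` A = set0) ?measure0//.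
  apply/seteqP; split => // y /= /AD;
    rewrite /D /= in_itv/= andbT dot2 /G /vec2/= G10 G20.
  by rewrite !mul0r addr0 ltxx.
(* [x * Jmu c mu] is the exponent of the pair [c * x], [x * mu], so uniqueness applies to it and to
   the projection along [G x]. *)
have uniq x (x0 : 0 < x) : 2^-1 * qform Q (G x) = c * x /\
    forall A, measurable A -> A `<=` D -> dot_image nu (G x) A =
      mscale (NngNum (ltW x0)) mu A.
  apply: (Jmu_inj (proj_vec_branching (G1_ge0 (ltW x0)) (G2_ge0 (ltW x0)))
    (scaled_branching c_mu (NngNum (ltW x0)))) => b b0.
  by rewrite Jmu_scale// -exponents_proj ?G1_ge0 ?G2_ge0 ?(ltW x0)// eqJ.
have G0 i : G 0 i = 0 by rewrite /G /vec2 G10 G20; case: ifP.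
split => //.
- rewrite -[ltLHS]/(\int[dot_image nu (G 0)]_(v in D) v%:E)%E.
  rewrite (@eq_measure_integral _ _ _ _ mzero) ?integral_measure_zero ?ltry//.
  by move=> A _ AD; exact: pull0.
- move=> x; rewrite le_eqVlt => /predU1P[<-|x0]; last by case: (uniq x x0).
  rewrite mulr0 /qform big1 ?mulr0// => i _; rewrite big1// => j _.
  by rewrite !G0 !mulr0.
- move=> x; rewrite le_eqVlt => /predU1P[<-|x0] A mA AD;
  first by rewrite mul0e adde0.
  by rewrite pull0// add0e; case: (uniq x x0) => _ /(_ A mA AD).
Qed.

End pair.

End generating.



(** * Uniqueness of exponents and the two cases of the theorem *)

Section laplace_exponents.
Context {d : measure_display} {T : measurableType d} {R : realType}.
Variables (P : probability T R) (Y : R -> T -> R) (K K' : R -> R).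

Lemma laplace_exponent_uniq : laplace_exponent P Y K -> laplace_exponent P Y K'
  ->
  forall b, 0 <= b -> K b = K' b.
Proof.
move=> lK lK' b b0; have := lK 1 b ler01 b0; rewrite (lK' 1 b ler01 b0) !mul1r.
by move=> [/expR_inj].
Qed.

Lemma eq_laplace_exponent : (forall b, 0 <= b -> K b = K' b) ->
  laplace_exponent P Y K -> laplace_exponent P Y K'.
Proof. by move=> KK' lK t b t0 b0; rewrite lK// KK'. Qed.

End laplace_exponents.

Lemma continuous_ge0_at0 (R : realType) (f : R -> R) :
  {within `[0, +oo[, continuous f} -> (forall x, 0 < x -> 0 < f x) ->
  forall x, 0 <= x -> 0 <= f x.
Proof.
move=> /continuous_within_itvcyP[_ f0] fp x;
  rewrite le_eqVlt => /predU1P[<-|/fp/ltW//].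
rewrite -(cvg_lim _ f0)//; apply: limr_ge; first by apply/cvg_ex; eexists;
  exact: f0.
by near=> y; rewrite ltW// fp.
Unshelve. all: by end_near. Qed.

Lemma powRK (R : realType) (y a : R) : 0 <= y -> a != 0 -> (y `^ a) `^ a^-1 = y.
Proof. by move=> y0 a0; rewrite -powRrM mulfV// powRr1. Qed.

Lemma powRVK (R : realType) (y a : R) : 0 <= y -> a != 0 -> (y `^ a^-1) `^ a =
  y.
Proof. by move=> y0 a0; rewrite -powRrM mulVf// powRr1. Qed.

Unset Implicit Arguments.

Theorem theorem3p8 (R : realType) (d : measure_display) (T : measurableType d)
  (P : probability T R)
  (G1 G2 : R -> R)
  (G1_cont : {within `[0, +oo[, continuous G1})
  (G2_cont : {within `[0, +oo[, continuous G2})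
  (G1_pos : forall x, 0 < x -> 0 < G1 x)
  (G2_pos : forall x, 0 < x -> 0 < G2 x)
  (G_C1 : C1_pos (fun x => G2 x / G1 x))
  (Z1 Z2 : R -> T -> R)
  (Z_levy : levy_martingale P (vec2 Z1 Z2))
  (Z1_jumps : nonneg_jumps P Z1)
  (Z2_jumps : nonneg_jumps P Z2)
  (Q : 'M[R]_2) (nu : {measure set (2.-tuple R) -> \bar R})
  (Z_char : levy_characteristics P (vec2 Z1 Z2) Q nu)
  (Z_indep : independent_processes P Z1 Z2)
  (Z1_infvar : infinite_variation P Z1)
  (Z2_infvar : infinite_variation P Z2)
  (J1 J2 : R -> R)
  (Z1_exponent : laplace_exponent P Z1 J1)
  (Z2_exponent : laplace_exponent P Z2 J2)
  (alpha1 alpha2 : R)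
  (alpha1_le2 : alpha1 <= 2) (alpha21 : alpha2 <= alpha1) (alpha2_gt1 : 1 < alpha2)
  (J1_regular : regularly_varying0 J1 alpha1)
  (J2_regular : regularly_varying0 J2 alpha2)
  (c : R) (mu : {measure set R -> \bar R})
  (c_mu : branching_parameters c mu) :
  (forall eta1 : R, 0 < eta1 ->
    (forall b, 0 <= b -> Jmu c mu b = eta1 * b `^ alpha1) ->
    (generating_pair (fun x => vec2 (G1 x) (G2 x)) Q nu c mu <->
     (exists g1 g2 : R,
        [/\ 0 < g1, 0 < g2,
            forall x, 0 <= x ->
              G1 x = (eta1 / c_stable alpha1) `^ alpha1^-1 * x `^ alpha1^-1 * g1 /\
              G2 x = (eta1 / c_stable alpha1) `^ alpha1^-1 * x `^ alpha1^-1 * g2,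
            stable_process P alpha1 (fun t w => g1 * Z1 t w + g2 * Z2 t w) &
            laplace_exponent P (fun t w => g1 * Z1 t w + g2 * Z2 t w)
              (fun b => c_stable alpha1 * b `^ alpha1)])
     \/
     (exists c1 c2 : R,
        [/\ 0 < c1 /\ 0 < c2,
            forall x, 0 <= x ->
              c1 * G1 x `^ alpha1 + c2 * G2 x `^ alpha1 = eta1 * x,
            stable_process P alpha1 Z1 /\ stable_process P alpha1 Z2,
            laplace_exponent P Z1 (fun b => c1 * b `^ alpha1) &
            laplace_exponent P Z2 (fun b => c2 * b `^ alpha1)])))
  /\
  (forall eta1 eta2 : R, 0 < eta1 -> 0 < eta2 -> alpha2 < alpha1 ->
    (forall b, 0 <= b ->
       Jmu c mu b = eta1 * b `^ alpha1 + eta2 * b `^ alpha2) ->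
    (generating_pair (fun x => vec2 (G1 x) (G2 x)) Q nu c mu <->
     exists c1 d2 : R,
       [/\ 0 < c1 /\ 0 < d2,
           forall x, 0 <= x ->
             G1 x = (eta1 / c1 * x) `^ alpha1^-1 /\
             G2 x = (eta2 / d2 * x) `^ alpha2^-1,
           stable_process P alpha1 Z1 /\ stable_process P alpha2 Z2,
           laplace_exponent P Z1 (fun b => c1 * b `^ alpha1) &
           laplace_exponent P Z2 (fun b => d2 * b `^ alpha2)])).

Proof.
have a20 : 0 < alpha2 by apply: lt_trans alpha2_gt1.
have a1_1 : 1 < alpha1 by apply: lt_le_trans alpha21.
have a10 : 0 < alpha1 by apply: lt_trans a1_1.
have a1n : alpha1 != 0 by exact: lt0r_neq0.
have a2n : alpha2 != 0 by exact: lt0r_neq0.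
have cs0 : 0 < c_stable alpha1 by exact: c_stable_gt0.
have G1_ge0 := continuous_ge0_at0 G1_cont G1_pos.
have G2_ge0 := continuous_ge0_at0 G2_cont G2_pos.
have gpP := generating_pairP Z_levy Z_char Z_indep Z1_infvar Z2_infvar
  Z1_exponent Z2_exponent G1_ge0 G2_ge0 c_mu.
have J10 := exponent0 Z1_exponent; have J20 := exponent0 Z2_exponent.
have J1_ge0 := exponent1_ge0 Z_levy Z_char Z_indep Z1_exponent Z2_exponent.
have J2_ge0 := exponent2_ge0 Z_levy Z_char Z_indep Z1_exponent Z2_exponent.
have J2_cvg := exponent2_cvg0 Z_levy Z_char Z_indep Z1_exponent Z2_exponent.
have J1_nl := exponent1_not_linear Z_levy Z1_infvar Z1_exponent.
have J2_nl := exponent2_not_linear Z_levy Z2_infvar Z2_exponent.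
have LZ g1 g2 := levy_martingale_combine g1 g2 Z_levy.
(* The martingale property is given in the filtration of the pair; the combination with coefficients
   1 and 0 restates it in the filtration of the coordinate. *)
have L1 : levy_martingale P (fun _ : 'I_1 => Z1).
  have := LZ 1 0; rewrite (_ : (fun t w => _) = Z1)//.
  by apply/funext => t; apply/funext => w; rewrite mul1r mul0r addr0.
have L2 : levy_martingale P (fun _ : 'I_1 => Z2).
  have := LZ 0 1; rewrite (_ : (fun t w => _) = Z2)//.
  by apply/funext => t; apply/funext => w; rewrite mul1r mul0r add0r.
have lap g1 g2 : 0 <= g1 -> 0 <= g2 ->
    laplace_exponent P (fun t w => g1 * Z1 t w + g2 * Z2 t w)
      (fun b => J1 (b * g1) + J2 (b * g2)).
  move=> g10 g20 t b t0 b0.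
  have [mX _ _ _ _] := Z_levy.1.
  rewrite -(laplace_indep Z_indep Z1_exponent Z2_exponent t0 (mX ord0 t t0)
    (mX ord_max t t0) (mulr_ge0 b0 g10) (mulr_ge0 b0 g20)).
  by congr expectation; apply/funext => w; congr expR; rewrite /vec2/=; ring.
(* A zero coefficient would make [J] vanish identically, hence grow at most linearly, against
   infinite variation. *)
have pos_coef (J : R -> R) (a k : R) : (forall b, 0 <= b -> 0 <= J b) ->
    (forall C, ~ (forall b, 0 <= b -> J b <= C * b)) -> J 0 = 0 ->
    (forall b, 0 < b -> J b = k * b `^ a) -> 0 < k.
  move=> Jge Jnl J0 JE; rewrite lt_def; apply/andP; split; last first.
    by have := Jge 1 ler01; rewrite JE// powR1 mulr1.
  apply/eqP => k0; apply: (Jnl 0) => b; rewrite le_eqVlt => /predU1P[<-|b0].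
    by rewrite J0 mulr0.
  by rewrite JE// k0 !mul0r.
have at0 (J : R -> R) (a k : R) : a != 0 -> J 0 = 0 -> (forall b,
  0 < b -> J b = k * b `^ a) ->
    forall b, 0 <= b -> J b = k * b `^ a.
  move=> an J0 JE b; rewrite le_eqVlt => /predU1P[<-|b0]; last exact: JE.
  by rewrite J0 powR0// mulr0.
split.
(* Dividing the direction vector by [s] turns the exponent [eta1 b^alpha1] into
   [c_stable alpha1 * b^alpha1]; [s] is then restored in front of [x^(1/alpha1)]. *)
- move=> eta1 eta10 HJ; pose s := (eta1 / c_stable alpha1) `^ alpha1^-1.
  have s0 : 0 < s by apply: powR_gt0; exact: divr_gt0.
  have sE : s `^ alpha1 = eta1 / c_stable alpha1 by rewrite powRVK ?divr_ge0
    ?ltW.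
  split=> [/gpP[G10 G20 eqJ]|].
    have H x b : 0 < x -> 0 < b ->
        J1 (b * G1 x) + J2 (b * G2 x) = x * (eta1 * b `^ alpha1).
      by move=> x0 b0; rewrite eqJ ?HJ// ltW.
    have [[g1 [g2 [g10 g20 GE JE]]]|[c1 [c2 [E1 E2 GE]]]] :=
        single_power_rigidity eta10 a10 G1_pos G2_pos J2_cvg H; [left|right].
      have lapE : laplace_exponent P (fun t w =>
        g1 / s * Z1 t w + g2 / s * Z2 t w)
          (fun b => c_stable alpha1 * b `^ alpha1).
        apply: (eq_laplace_exponent _ (lap (g1 / s) (g2 / s) _ _)) => [b||].
        - apply: (at0 (fun b => J1 (b * (g1 / s)) + J2 (b * (g2 / s)))) => //.
            by rewrite !mul0r J10 J20 addr0.
          move=> {}b b0; rewrite !(mulrCA b) -!(mulrC (b / s)) JE ?divr_gt0//.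
          rewrite powRM ?invr_ge0 ?ltW// powRV ?ltW// sE.
          by field; rewrite !gt_eqF.
        - by rewrite divr_ge0 // ltW.
        - by rewrite divr_ge0 // ltW.
      exists (g1 / s), (g2 / s); split;
        [exact: divr_gt0|exact: divr_gt0| | |exact: lapE].
        move=> x; rewrite le_eqVlt => /predU1P[<-|x0].
          by rewrite G10 G20 powR0 ?invr_eq0// mulr0 !mul0r.
        have [-> ->] := GE x x0; rewrite -/s.
        by split; field; rewrite gt_eqF.
      by apply: (stable_of_exponent a1_1 alpha1_le2 cs0) => //; exact: LZ.
    have c10 : 0 < c1 by apply: (pos_coef J1 alpha1).
    have c20 : 0 < c2 by apply: (pos_coef J2 alpha1).
    have l1 : laplace_exponent P Z1 (fun b => c1 * b `^ alpha1).
      by apply: (eq_laplace_exponent _ Z1_exponent); exact: at0.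
    have l2 : laplace_exponent P Z2 (fun b => c2 * b `^ alpha1).
      by apply: (eq_laplace_exponent _ Z2_exponent); exact: at0.
    exists c1, c2; split => //.
    - move=> x; rewrite le_eqVlt => /predU1P[<-|x0]; last exact: GE.
      by rewrite G10 G20 powR0// !mulr0 addr0.
    - by split; [exact: (stable_of_exponent a1_1 alpha1_le2 c10)|
        exact: (stable_of_exponent a1_1 alpha1_le2 c20)].
  case=> [[g1 [g2 [g10 g20 GE _ lapE]]]|[c1 [c2 [[c10 c20] GE _ l1 l2]]]].
    have JE := laplace_exponent_uniq (lap g1 g2 (ltW g10) (ltW g20)) lapE.
    apply/gpP; split.
    - by have [-> _] := GE 0 (lexx 0); rewrite powR0 ?invr_eq0// mulr0 mul0r.
    - by have [_ ->] := GE 0 (lexx 0); rewrite powR0 ?invr_eq0// mulr0 mul0r.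
    - move=> x b x0 b0; have [-> ->] := GE x (ltW x0); rewrite -/s.
      have p0 : 0 <= s * x `^ alpha1^-1 by rewrite mulr_ge0 ?powR_ge0.
      rewrite !(mulrA b (s * x `^ alpha1^-1)) (JE _ (mulr_ge0 b0 p0)) HJ//.
      rewrite powRM// powRM ?powR_ge0 ?(ltW s0)// powRVK ?(ltW x0)// sE.
      by field; rewrite gt_eqF.
  have J1E := laplace_exponent_uniq Z1_exponent l1.
  have J2E := laplace_exponent_uniq Z2_exponent l2.
  (* Two nonnegative terms add up to 0 at [x = 0], so both vanish and [G 0 = 0]. *)
  have GE0 := GE 0 (lexx 0); rewrite mulr0 in GE0.
  have h1 : 0 <= c1 * G1 0 `^ alpha1 by rewrite mulr_ge0 ?powR_ge0// ltW.
  have h2 : 0 <= c2 * G2 0 `^ alpha1 by rewrite mulr_ge0 ?powR_ge0// ltW.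
  apply/gpP; split.
  - apply: (@powR_eq0_eq0 _ _ alpha1); apply: (mulfI (lt0r_neq0 c10)); lra.
  - apply: (@powR_eq0_eq0 _ _ alpha1); apply: (mulfI (lt0r_neq0 c20)); lra.
  - move=> x b x0 b0; have G1x := ltW (G1_pos x x0);
    have G2x := ltW (G2_pos x x0).
    rewrite J1E ?J2E ?mulr_ge0// HJ// !powRM//.
    transitivity (b `^ alpha1 * (c1 * G1 x `^ alpha1 + c2 * G2 x `^ alpha1)).
      by ring.
    by rewrite GE ?ltW//; ring.
move=> eta1 eta2 eta10 eta20 a12 HJ; split=> [/gpP[G10 G20 eqJ]|].
  have H x b : 0 < x -> 0 < b ->
      J1 (b * G1 x) + J2 (b * G2 x) =
        x * (eta1 * b `^ alpha1 + eta2 * b `^ alpha2).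
    by move=> x0 b0; rewrite eqJ ?HJ// ltW.
  have J1p b : 0 < b -> 0 <= J1 b by move=> /ltW; exact: J1_ge0.
  have J2p b : 0 < b -> 0 <= J2 b by move=> /ltW; exact: J2_ge0.
  have [c1 [d2 [[c10 d20] E1 E2 GE]]] := two_power_rigidity eta10 eta20 a20 a12
    G1_pos G2_pos J1p J2p J2_cvg J1_regular H.
  have l1 : laplace_exponent P Z1 (fun b => c1 * b `^ alpha1).
    by apply: (eq_laplace_exponent _ Z1_exponent); exact: at0.
  have l2 : laplace_exponent P Z2 (fun b => d2 * b `^ alpha2).
    by apply: (eq_laplace_exponent _ Z2_exponent); exact: at0.
  exists c1, d2; split => //.
    move=> x; rewrite le_eqVlt => /predU1P[<-|x0].
      by rewrite G10 G20 !mulr0 !powR0 ?invr_eq0.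
    have [h1 h2] := GE x x0; rewrite !(mulrAC _ _^-1) -h1 -h2.
    by rewrite !(mulrC c1) !(mulrC d2) !mulfK ?gt_eqF// !powRK ?G1_ge0 ?G2_ge0
      ?ltW.
  split; first exact: (stable_of_exponent a1_1 alpha1_le2 c10).
  by apply: (stable_of_exponent alpha2_gt1 _ d20) => //;
    exact: le_trans alpha1_le2.
move=> [c1 [d2 [[c10 d20] GE _ l1 l2]]].
have J1E := laplace_exponent_uniq Z1_exponent l1.
have J2E := laplace_exponent_uniq Z2_exponent l2.
apply/gpP; split.
- by have [-> _] := GE 0 (lexx 0); rewrite mulr0 powR0 ?invr_eq0.
- by have [_ ->] := GE 0 (lexx 0); rewrite mulr0 powR0 ?invr_eq0.
- move=> x b x0 b0; have [-> ->] := GE x (ltW x0).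
  have p1 : 0 <= eta1 / c1 * x by rewrite mulr_ge0 ?divr_ge0 ?ltW.
  have p2 : 0 <= eta2 / d2 * x by rewrite mulr_ge0 ?divr_ge0 ?ltW.
  rewrite J1E ?J2E ?mulr_ge0 ?powR_ge0// HJ//.
  rewrite !(powRM _ b0 (powR_ge0 _ _)) !powRVK//.
  by field; rewrite !gt_eqF.
Qed.
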